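(* Let $\xi$ be a spectrally positive Lévy process with Laplace exponent $\psi$, $p:=\Phi(0)\in(0,\infty)$ and $\gamma:=\mathbb{E}(\xi_1)\in(0,\infty)$, and let $\rho$ be its stationary overshoot distribution. Then for $s\ge0$ $$\widehat{\rho}(s):=\int_{0-}^{\infty}e^{-sz}\rho(dz)=\frac{p\,\psi(s)}{\gamma s(s-p)},$$ where the right-hand side is understood as its continuous extension at $s=0$ and $s=p$. In particular, $\widehat{\rho}(p)=(\gamma\Phi'(0))^{-1}$.
   Context: $\xi$ is a spectrally positive Lévy process: a real-valued process with stationary independent increments and no negative jumps, not a subordinator; $\mathbb{P}$ is its law when $\xi_0=0$. Its Laplace exponent is $\psi(s)=t^{-1}\log\mathbb{E}(e^{-s\xi_t})$, $s\ge0$, and $\Phi(t):=\sup\{s\ge0:\psi(s)=t\}$; $p:=\Phi(0)$ and $\gamma:=\mathbb{E}(\xi_1)=-\psi'(0)$. With $\tau_y^+:=\inf\{t>0:\xi_t>y\}$, the stationary overshoot distribution $\rho$ is the probability measure on $[0,\infty)$ that is the weak limit of $\mathbb{P}(\xi(\tau_y^+)-y\in dz)$ as $y\to\infty$; this limit is known to exist when $\gamma\in(0,\infty)$. *)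

(* Defs.v *)
From HB Require Import structures.
From mathcomp Require Import all_boot all_order all_algebra.
From mathcomp Require Import all_classical all_reals all_analysis.

Set Implicit Arguments.
Unset Strict Implicit.
Unset Printing Implicit Defensive.

Import Order.TTheory GRing.Theory Num.Theory.
Import numFieldNormedType.Exports.

Local Open Scope classical_set_scope.
Local Open Scope ring_scope.

Section levy.
Context d (T : measurableType d) (R : realType) (P : probability T R).

(* A process is indexed by all of R, but only its values at times t >= 0 are
   ever constrained or used. *)
Implicit Types xi : R -> {RV P >-> R}.

Definition independent_increments xi :=
  forall (n : nat) (t : nat -> R) (B : nat -> set R),
    0 <= t 0%N -> (forall i, (i < n)%N -> t i <= t i.+1) ->
    (forall i, (i < n)%N -> measurable (B i)) ->
    P [set w | forall i, (i < n)%N -> B i (xi (t i.+1) w - xi (t i) w)] =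
    (\prod_(i < n) P [set w | B i (xi (t i.+1) w - xi (t i) w)%R])%E.

Definition stationary_increments xi :=
  forall (s t : R) (B : set R), 0 <= s -> 0 <= t -> measurable B ->
    P [set w | B (xi (s + t) w - xi s w)] =
    P [set w | B (xi t w - xi 0 w)].

Definition cadlag (x : R -> R) :=
  (forall t : R, 0 <= t -> x u @[u --> t^'+] --> x t) /\
  (forall t : R, 0 < t -> cvg (x u @[u --> t^'-])).

Definition levy_process xi :=
  [/\ {ae P, forall w, xi 0 w = 0},
      forall w, cadlag (fun t => xi t w),
      independent_increments xi &
      stationary_increments xi].

Definition no_negative_jumps xi :=
  {ae P, forall w, forall t : R, 0 < t -> lim (xi u w @[u --> t^'-]) <= xi t w}.

Definition nondecreasing_paths xi :=
  {ae P, forall w, forall s t : R, 0 <= s -> s <= t -> xi s w <= xi t w}.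

Definition spectrally_positive xi :=
  [/\ levy_process xi, no_negative_jumps xi & ~ nondecreasing_paths xi].

(* psi s = t^-1 log E(e^(- s xi_t)), for every t > 0; lne is the logarithm with
   lne 0 = -oo and lne +oo = +oo. Only the values psi s with s >= 0 matter. *)
Definition is_laplace_exponent xi (psi : R -> R) :=
  forall s t : R, 0 <= s -> 0 < t ->
    (psi s)%:E = ((t^-1)%R%:E * lne ('M_P (xi t) (- s)%R))%E.

(* inf set0 = 0, so first_passage is a junk value on the paths that never exceed
   y; these form a null set when E(xi_1) > 0. *)
Definition first_passage xi (y : R) (w : T) : R :=
  inf [set t : R | 0 < t /\ y < xi t w].

Definition overshoot xi (y : R) (w : T) : R :=
  xi (first_passage xi y w) w - y.

(* Probability measures on [0, +oo[ are rendered as probability measures on the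
   real line that give no mass to ]-oo, 0[; convergence is weak convergence,
   tested on the bounded continuous functions. *)
Definition is_stationary_overshoot xi (rho : probability R R) :=
  rho [set` `]-oo, 0%R[] = 0%E /\
  forall f : R -> R, continuous f -> (exists M : R, forall z, `|f z| <= M) ->
    ('E_P[fun w => f (overshoot xi y w)])%E @[y --> +oo] -->
    (\int[rho]_z (f z)%:E)%E.

End levy.

Section real_functions.
Context (R : realType).

(* sup A = 0 when A is empty or unbounded above; hence 0 < Phi psi 0 says that
   the supremum defining Phi at 0 is a genuine one, in ]0, +oo[. *)
Definition Phi (psi : R -> R) (t : R) : R := sup [set s | 0 <= s /\ psi s = t].

Definition laplace_transform (rho : probability R R) (s : R) :
  \bar R := (\int[rho]_(z in [set` `[0%R, +oo[]) (expR (- (s * z)%R)%R)%:E)%E.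

(* g is the continuous extension to D of the function f, given on D `\` E *)
Definition is_continuous_extension (D E : set R) (f g : R -> R) :=
  (forall x, D x -> ~ E x -> g x = f x) /\ {within D, continuous g}.

End real_functions.

(* Main.v *)
(* The process is observed on the dyadic grid of mesh h = 2^-m. Let u(y) be the
   Laplace transform at s of the overshoot of the grid walk over the level y,
   extended by e^(s y) to y < 0, and let M(q) = E e^(- q xi_h) = e^(h psi(q)).
   The Markov property at the first step gives u(y) = E u(y - xi_h) for y >= 0,
   and integrating this against e^(- q y) gives
     (1 - M(q)) A(q) = (M(s) - M(q)) / (q - s) + D(q),
   where A is the Laplace transform of u on [0, +oo[ and D(q) >= 0 collects the
   downward steps of the walk across the level, where the first-step relation for
   u breaks down.
   Since there are no negative jumps, D(q) depends on q only up to o(h), and at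
   a root r > 0 of psi, where M(r) = 1, the identity determines D(r). Dividing
   by h and letting m tend to infinity,
     - psi(q) A(q) = (psi(s) - psi(q)) / (q - s) + psi(s) / (s - r).
   As q -> 0+, q A(q) tends to the Laplace transform of rho at s, because the
   overshoots converge weakly, and psi(q) / q tends to - gamma. Continuity of the
   Laplace transform of rho then fills in s = 0 and s = p, and the formula itself
   shows that r = p is the only positive root and gives the derivative of Phi. *)

Require Import Defs.
From HB Require Import structures.
From mathcomp Require Import all_boot all_order all_algebra.
From mathcomp Require Import all_classical all_reals all_analysis.
From mathcomp Require Import measurable_realfun ring lra.

Import Order.TTheory GRing.Theory Num.Theory.
Import numFieldNormedType.Exports.

Local Open Scope classical_set_scope.
Local Open Scope ring_scope.

(** Levels are reflected: [z = - y] is the position of the walk relative to the level, so the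
    weights read e^(q z) on z <= 0 and exit means z > 0. The identity is divided by h, so every
    error has to be o(h). D(q) and D(r) differ only through the weights e^(q (z - x)) and e^(r (z -
    x)) inside a downward step x. Steps above - delta change these by a relative O(delta), and D(r)
    is itself O(h); the exponentially weighted tail below - delta is o(h), which is where the
    absence of negative jumps enters, through the independence of the 2^m increments on [0, 1].
    Paths that never exceed y carry a weight of at most e^(- s y), which vanishes as y grows. No
    regularity of psi is assumed. The identity is proved for an arbitrary positive root r;
    afterwards the formula expresses psi through the transform of rho, which is continuous and
    positive, and psi inherits its continuity and its signs from there. The derivative of Phi at 0
    is two-sided, so small t < 0 matter as well: there the supremum selects the root near p and not
    the one near 0. *)

(** * Translations and exponential integrals for the Lebesgue measure *)

Section lebesgue.
Context {R : realType}.
Local Notation leb := (@lebesgue_measure R).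

Lemma lebesgue_measure_shift (a : R) (A : set R) : measurable A ->
  leb [set x | A (x + a)] = leb A.
Proof.
move=> mA.
have ma : measurable_fun setT ((fun x => x + a) : measurableTypeR R -> measurableTypeR R).
  exact: measurable_funD.
pose a_mixin := isMeasurableFun.Build _ _ _ _ _ ma.
pose a_mfun : {mfun _ >-> _} := HB.pack ((fun x => x + a) : measurableTypeR R -> measurableTypeR R) a_mixin.
transitivity (pushforward leb a_mfun A) => //.
apply/esym/lebesgue_measure_unique => //= _ [[u v]] _ <-.
rewrite /pushforward (_ : _ @^-1` _ = `]u - a, v - a]%classic); last first.
  by apply/seteqP; split => x /=; rewrite !in_itv/= ltrBlDr lerBrDr.
rewrite !lebesgue_measure_itv/= !lte_fin ltrD2r -EFinB -EFinB.
by rewrite opprB addrA subrK.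
Qed.

Local Open Scope ereal_scope.

Lemma ge0_integral_shift (f : R -> \bar R) (a : R) (D : set R) :
  measurable D ->
  measurable_fun [set: R] f -> (forall x, 0 <= f x) ->
  \int[leb]_(x in [set x | D (x + a)%R]) f (x + a)%R = \int[leb]_(x in D) f x.
Proof.
move=> mD mf f0.
have ma : measurable_fun setT ((fun x => x + a)%R : measurableTypeR R -> measurableTypeR R).
  exact: measurable_funD.
rewrite -[LHS](@ge0_integral_pushforward _ _ _ _ _ _ ma)//; last exact: measurable_funTS.
by apply: eq_measure_integral => A mA _; exact: lebesgue_measure_shift.
Qed.

Lemma continuous_expRM (k : R) : continuous (fun x : R => expR (k * x)).
Proof.
move=> x; apply: (@continuous_comp _ _ _ (fun x => (k * x)%R) expR).
  exact: mulrl_continuous.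
exact: continuous_expR.
Qed.

Lemma measurable_expRM (k : R) : measurable_fun setT (fun x : R => expR (k * x)).
Proof. by apply: measurableT_comp => //; exact: mulrl_measurable. Qed.

Lemma is_derive_expRM (k x : R) :
  is_derive x 1%R (fun x : R => expR (k * x) / k)%R (k * expR (k * x) / k)%R.
Proof.
have h : is_derive x 1%R ( *%R k) k.
  by apply: is_derive_eq; rewrite scaler1 ?mulr1.
have h2 := @is_derive1_comp _ expR ( *%R k) x _ _ (is_derive_expR (k * x)) h.
have -> : (k * expR (k * x) / k)%R = (k^-1 *: (expR (k * x) * k))%R.
  by rewrite /GRing.scale/=; ring.
have -> : (fun x : R => expR (k * x) / k)%R = (k^-1 \*: (expR \o *%R k))%R.
  by apply/funext => y /=; rewrite /GRing.scale/= mulrC.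
exact: is_deriveZ.
Qed.

Lemma integrable_expRM (k a b : R) :
  leb.-integrable `]a, b] (EFin \o (fun x : R => expR (k * x))).
Proof.
have h : leb.-integrable `[a, b] (EFin \o (fun x : R => expR (k * x))).
  apply: continuous_compact_integrable; first exact: segment_compact.
  exact/continuous_subspaceT/continuous_expRM.
by apply: integrableS h => //; exact: subset_itv_oc_cc.
Qed.

Lemma integral_expRM (k a b : R) : k != 0%R -> (a <= b)%R ->
  \int[leb]_(x in `]a, b]) (expR (k * x))%:E =
  ((expR (k * b) - expR (k * a)) / k)%:E.
Proof.
move=> k0; rewrite le_eqVlt => /predU1P[->|ab].
  by rewrite set_itvoc0 integral_set0 subrr mul0r.
have cF : continuous (fun x : R => expR (k * x) / k)%R.
  by move=> x; apply: cvgMl; exact: continuous_expRM.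
rewrite integral_itv_obnd_cbnd; last first.
  by apply/measurable_EFinP/measurable_funTS; exact: measurable_expRM.
rewrite (@continuous_FTC2 _ _ (fun x => expR (k * x) / k)%R)//.
- by rewrite -EFinB -mulrBl.
- exact/continuous_subspaceT/continuous_expRM.
- split.
  + by move=> x _; have [] := is_derive_expRM k x.
  + by apply/cvg_at_right_filter/cF.
  + by apply/cvg_at_left_filter/cF.
- move=> x _; rewrite derive1E; have := is_derive_expRM k x.
  by move=> /@derive_val ->; field.
Qed.

Lemma integral_expRNy (k b : R) : (0 < k)%R ->
  \int[leb]_(x in `]-oo, b]) (expR (k * x))%:E = (expR (k * b) / k)%:E.
Proof.
move=> k0.
have me : measurable_fun [set: R] (fun x => (expR (k * x))%:E).
  by apply/measurable_EFinP; exact: measurable_expRM.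
have h0 : \int[leb]_(x in `]-oo, 0%R]) (expR (k * x))%:E = (k^-1)%:E.
  transitivity (\int[leb]_(x in `[(0 : R)%R, +oo[) (expR (- k * x))%:E).
    rewrite (@ge0_integration_by_substitution0 _ (fun x : R => (expR (- k * x))%:E)) //.
    - by apply: eq_integral => x _; rewrite mulrNN.
    - apply/measurable_EFinP; exact: measurable_expRM.
  have mE : measurable_fun [set: R] (fun x => (expR (- k * x))%:E).
    apply/measurable_EFinP; exact: measurable_expRM.
  have : k%:E * \int[leb]_(x in `[0%R, +oo[) (expR (- k * x))%:E = 1.
    rewrite -(integral_exponential_pdf k0) -ge0_integralZl//; first last.
    - by rewrite lee_fin ltW.
    - exact: measurable_funTS.
    rewrite integral_mkcond; apply: eq_integral => x _.
    by rewrite /exponential_pdf !patchE; case: ifP.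
  move=> h; rewrite -[LHS]mul1e -[1](_ : (k^-1 * k)%R%:E = _); last by rewrite mulVf ?gt_eqF.
  by rewrite EFinM -muleA h mule1.
rewrite -(@ge0_integral_shift _ b)//=.
rewrite [X in integral _ X _](_ : _ = `]-oo, 0%R]%classic); last first.
  by apply/seteqP; split => x /=; rewrite !in_itv/=; lra.
under eq_integral do rewrite mulrDr expRD mulrC EFinM.
rewrite ge0_integralZl//.
- by rewrite h0.
- exact: measurable_funTS.
Qed.

End lebesgue.

(** * The identity for one step of a random walk *)

Section one_step.
Context {R : realType} (mu : probability R R) (U M : R -> R) (s : R).
Local Notation leb := (@lebesgue_measure R).
Hypothesis mU : measurable_fun setT U.
Hypothesis U01 : forall z, 0 <= U z <= 1.
Hypothesis s_gt0 : 0 < s.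
Hypothesis U_gt0 : forall z, 0 < z -> U z = expR (- s * z).
Hypothesis U_le0 : forall z, z <= 0 ->
  (U z)%:E = (\int[mu]_x (U (z + x))%:E)%E.
Hypothesis ME : forall c, 0 <= c -> (\int[mu]_x (expR (- c * x))%:E)%E = (M c)%:E.

(** [J c 0] is A(c) in the reflected variable. [w] vanishes above the level and is nonnegative below
    it, where e^(- s z) >= 1 >= U z. [K c x] is the defect caused by a step [x < 0]; for [x >= 0]
    its domain is empty. *)
Let J (c b : R) := \int[leb]_(z in `]-oo, b]) (expR (c * z) * U z).
Let w (z : R) := expR (- s * z) - U z.
Let K (c x : R) := \int[leb]_(z in `]x, 0]) (expR (c * (z - x)) * w z).

Let mexpU (c : R) : measurable_fun setT (fun z : R => expR (c * z) * U z).
Proof. by apply: measurable_funM => //; exact: measurable_expRM. Qed.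

Let w_ge0 z : 0 <= w z.
Proof.
rewrite subr_ge0; have [z0|z0] := leP z 0; last by rewrite U_gt0.
have /andP[_ /le_trans] := U01 z; apply.
by rewrite -expR0 ler_expR mulr_le0 // oppr_le0 ltW.
Qed.

Let mw : measurable_fun setT w.
Proof. by apply: measurable_funB => //; exact: measurable_expRM. Qed.

Let mexpw (c x : R) : measurable_fun setT (fun z : R => expR (c * (z - x)) * w z).
Proof.
apply: measurable_funM => //.
apply: (measurableT_comp (measurable_expRM c)).
exact: measurable_funB.
Qed.

Let integrableJ (c b : R) : 0 < c ->
  leb.-integrable `]-oo, b] (EFin \o (fun z : R => expR (c * z) * U z)).
Proof.
move=> c0.
have ie : leb.-integrable `]-oo, b] (EFin \o (fun z : R => expR (c * z))).
  apply/integrableP; split.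
    by apply/measurable_EFinP/measurable_funTS; exact: measurable_expRM.
  under eq_integral do rewrite /= ger0_norm ?expR_ge0//.
  by rewrite integral_expRNy// ltry.
apply: le_integrable ie => //.
- by apply/measurable_EFinP/measurable_funTS; exact: mexpU.
- move=> z _; rewrite !abse_EFin lee_fin !ger0_norm ?expR_ge0//.
    by have /andP[_] := U01 z; rewrite -{2}[expR _]mulr1 ler_pM2l ?expR_gt0.
  by rewrite mulr_ge0 ?expR_ge0//; have /andP[] := U01 z.
Qed.

Let integrableK (c x : R) : 0 <= c ->
  leb.-integrable `]x, 0] (EFin \o (fun z : R => expR (c * (z - x)) * w z)).
Proof.
move=> c0; apply: measurable_bounded_integrable => //.
- by rewrite /= lebesgue_measure_itv/=; case: ifP => _; rewrite -?EFinB ltry.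
- by apply: measurable_funTS; exact: mexpw.
- exists (expR (c * - x) * expR (- s * x)); split; first exact: num_real.
  move=> y ylt z; rewrite /= in_itv/= => /andP[xz z0].
  rewrite ger0_norm ?mulr_ge0 ?expR_ge0//.
  apply: (le_trans _ (ltW ylt)); apply: ler_pM => //.
    by rewrite ler_expR ler_wpM2l//; lra.
  rewrite lerBlDr ler_wpDr//; first by have /andP[] := U01 z.
  by rewrite ler_expR !mulNr lerN2 ler_wpM2l// ltW.
Qed.

(** The relation [U_le0] on z <= 0 is integrated against e^(c z). After exchanging the integrals,
    the translation by [x] moves the endpoint from 0 to [x] and leaves the factor e^(- c x). *)
Let fubiniA (c : R) : 0 < c ->
  (J c 0)%:E = (\int[mu]_x (expR (- c * x) * J c x)%:E)%E.
Proof.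
move=> c0.
have JE b : (J c b)%:E = (\int[leb]_(z in `]-oo, b]) (expR (c * z) * U z)%:E)%E.
  by rewrite /J /Rintegral fineK//; apply: integrable_fin_num => //; exact: integrableJ.
rewrite JE integral_mkcond.
pose f (zx : R * R) : \bar R :=
  (\1_(`]-oo, 0%R]%classic) zx.1 * (expR (c * zx.1) * U (zx.1 + zx.2)))%:E.
have mf : measurable_fun setT f.
  apply/measurable_EFinP; apply: measurable_funM.
    by apply: measurableT_comp => //; exact: measurable_indic.
  apply: measurable_funM.
    by apply: (measurableT_comp (measurable_expRM c)).
  apply: measurableT_comp => //; exact: measurable_funD.
have f0 zx : (0 <= f zx)%E.
  rewrite lee_fin mulr_ge0//.
  by rewrite mulr_ge0 ?expR_ge0//; have /andP[] := U01 (zx.1 + zx.2).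
transitivity ((\int[leb]_z \int[mu]_x f (z, x))%E).
  apply: eq_integral => z _; rewrite patchE /f/= indicE.
  case: ifP => zin; last first.
    by under eq_integral do rewrite mul0r; rewrite integral0.
  under eq_integral do rewrite mul1r EFinM.
  rewrite ge0_integralZl//.
  - by rewrite -U_le0 ?EFinM//; move: zin; rewrite inE/= in_itv.
  - apply/measurable_EFinP; apply: measurableT_comp => //; exact: measurable_funD.
  - by move=> x _; rewrite lee_fin; have /andP[] := U01 (z + x).
rewrite (@fubini_tonelli _ _ _ _ _ leb mu f)//.
apply: eq_integral => x _.
rewrite EFinM JE -(@ge0_integral_shift _ (fun z : R => (expR (c * z) * U z)%:E) x)//; last 2 first.
  by apply/measurable_EFinP; exact: mexpU.
  by move=> z; rewrite lee_fin mulr_ge0 ?expR_ge0//; have /andP[] := U01 z.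
have -> : [set z | (z + x)%R \in `]-oo, x]] = `]-oo, 0%R]%classic.
  by apply/seteqP; split => z /=; rewrite !in_itv/=; lra.
rewrite -ge0_integralZl//; first last.
- by move=> z _; rewrite lee_fin mulr_ge0 ?expR_ge0//; have /andP[] := U01 (z + x).
- apply/measurable_EFinP/measurable_funTS.
  apply: (measurableT_comp (mexpU c)); exact: measurable_funD.
rewrite [RHS]integral_mkcond; apply: eq_integral => z _.
rewrite patchE /f/= indicE.
case: ifP => _; last by rewrite mul0r.
rewrite mul1r -EFinM mulrA -expRD; congr (expR _ * _)%:E; ring.
Qed.

(** Moving the endpoint from 0 to [x] costs the integral of e^(c z) U(z) between them. With e^(- s
    z) in place of U this is the quotient by [c - s]. For [x >= 0] the replacement is exact; for
    [x < 0] its error is the integral of [w], namely [K c x]. *)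
Let decomp (c x : R) : 0 < c -> c != s ->
  expR (- c * x) * J c x = expR (- c * x) * J c 0 +
    (expR (- s * x) - expR (- c * x)) / (c - s) + K c x.
Proof.
move=> c0 cs.
have cs0 : c - s != 0 by rewrite subr_eq0.
have ee z : expR (c * z) * expR (- s * z) = expR ((c - s) * z).
  by rewrite -expRD; congr expR; ring.
have ie a b : leb.-integrable `]a, b] (EFin \o (fun z : R => expR ((c - s) * z))).
  exact: integrable_expRM.
have [x0|x0] := leP 0 x.
  rewrite [K c x]/K set_itv_ge ?bnd_simp -?leNgt// Rintegral_set0 addr0.
  have -> : J c x = J c 0 + \int[leb]_(z in `]0, x]) (expR (c * z) * U z).
    apply/eqP; rewrite addrC -subr_eq; apply/eqP.
    rewrite /J Rintegral_itvB ?bnd_simp//; exact: integrableJ.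
  have -> : \int[leb]_(z in `]0, x]) (expR (c * z) * U z) =
      (expR ((c - s) * x) - 1) / (c - s).
    rewrite (@eq_Rintegral _ _ _ leb _ (fun z : R => expR ((c - s) * z))); last first.
      by move=> z; rewrite inE/= in_itv/= => /andP[z0 _]; rewrite U_gt0// ee.
    by rewrite /Rintegral integral_expRM//= mulr0 expR0.
  rewrite mulrDr; congr (_ + _).
  rewrite mulrA; congr (_ / _).
  by rewrite mulrBr -expRD mulr1; congr (expR _ - _); ring.
have JB : J c 0 - J c x = \int[leb]_(z in `]x, 0]) (expR (c * z) * U z).
  by rewrite /J Rintegral_itvB ?bnd_simp//; [exact: integrableJ|exact: ltW].
have KE : K c x = expR (- c * x) * ((1 - expR ((c - s) * x)) / (c - s) - (J c 0 - J c x)).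
  rewrite JB.
  have -> : (1 - expR ((c - s) * x)) / (c - s) =
      \int[leb]_(z in `]x, 0]) expR ((c - s) * z).
    by rewrite /Rintegral integral_expRM ?(ltW x0)//= mulr0 expR0.
  have iU : leb.-integrable `]x, 0] (EFin \o (fun z : R => expR (c * z) * U z)).
    apply: integrableS (integrableJ c 0 c0) => //.
    by move=> z /=; rewrite !in_itv/= => /andP[].
  rewrite -RintegralB// -RintegralZl//; last first.
    exact: (integrableB _ (ie _ _) iU).
  apply: eq_Rintegral => z _.
  rewrite -ee /w.
  have -> : expR (c * (z - x)) = expR (- c * x) * expR (c * z).
    by rewrite -expRD; congr expR; ring.
  by ring.
rewrite KE.
have -> : expR (- c * x) * ((1 - expR ((c - s) * x)) / (c - s) - (J c 0 - J c x)) =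
  (expR (- c * x) - expR (- s * x)) / (c - s) - expR (- c * x) * (J c 0 - J c x).
  rewrite mulrBr mulrA; congr (_ / _ - _).
  by rewrite mulrBr mulr1 -expRD; congr (_ - expR _); ring.
by field.
Qed.

Let K_ge0 c x : 0 <= K c x.
Proof. by apply: Rintegral_ge0 => z _; rewrite mulr_ge0 ?expR_ge0. Qed.

Let nondecreasingJ c : 0 < c -> {homo J c : x y / x <= y}.
Proof.
move=> c0 x y xy; rewrite -subr_ge0 /J Rintegral_itvB ?bnd_simp//.
  by apply: Rintegral_ge0 => z _; rewrite mulr_ge0 ?expR_ge0//; have /andP[] := U01 z.
exact: integrableJ.
Qed.

Let mexpJ c : 0 < c -> measurable_fun setT (fun x : R => expR (- c * x) * J c x).
Proof.
move=> c0; apply: measurable_funM; first exact: measurable_expRM.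
by apply: nondecreasing_measurable => // x y xy; exact: nondecreasingJ.
Qed.

Let integrable_expJ c : 0 < c ->
  mu.-integrable setT (EFin \o (fun x : R => expR (- c * x) * J c x)).
Proof.
move=> c0; apply/integrableP; split; first by apply/measurable_EFinP; exact: mexpJ.
under eq_integral.
  move=> x _; rewrite /= ger0_norm; last first.
    rewrite mulr_ge0 ?expR_ge0//; apply: Rintegral_ge0 => z _.
    by rewrite mulr_ge0 ?expR_ge0//; have /andP[] := U01 z.
  over.
by rewrite -fubiniA// ltry.
Qed.

Let integrable_exp c : 0 <= c ->
  mu.-integrable setT (EFin \o (fun x : R => expR (- c * x))).
Proof.
move=> c0; apply/integrableP; split; first by apply/measurable_EFinP; exact: measurable_expRM.
under eq_integral do rewrite /= ger0_norm ?expR_ge0//.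
by rewrite ME// ltry.
Qed.

Let RME c : 0 <= c -> \int[mu]_x expR (- c * x) = M c.
Proof. by move=> c0; rewrite /Rintegral ME. Qed.

Let integrable_expB c : 0 < c -> mu.-integrable setT
  (EFin \o (fun x : R => expR (- s * x) - expR (- c * x))).
Proof.
move=> c0.
exact: (integrableB _ (integrable_exp s (ltW s_gt0)) (integrable_exp c (ltW c0))).
Qed.

Let integrable_expAs c : 0 < c -> mu.-integrable setT
   (EFin \o (fun x : R => expR (- c * x) * J c 0 +
    (expR (- s * x) - expR (- c * x)) / (c - s))).
Proof.
move=> c0.
have h1 : mu.-integrable setT (EFin \o (fun x : R => expR (- c * x) * J c 0)).
  exact: (integrableZr _ _ (integrable_exp c (ltW c0))).
have h2 : mu.-integrable setT
    (EFin \o (fun x : R => (expR (- s * x) - expR (- c * x)) / (c - s))).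
  apply: (integrableZr _ _ (integrable_expB c c0)) => //.
exact: (integrableD _ h1 h2).
Qed.

Let integrableKmu c : 0 < c -> c != s -> mu.-integrable setT (EFin \o K c).
Proof.
move=> c0 cs.
have -> : K c = (fun x => expR (- c * x) * J c x - (expR (- c * x) * J c 0 +
    (expR (- s * x) - expR (- c * x)) / (c - s))).
  by apply/funext => x; rewrite decomp// addrC addKr.
exact: (integrableB _ (integrable_expJ c c0) (integrable_expAs c c0)).
Qed.

Let D c := \int[mu]_x K c x.

(** [decomp] averaged over the step law: by [fubiniA] its left-hand side averages to [J c 0]. *)
Let balance c : 0 < c -> c != s ->
  (1 - M c) * J c 0 = (M s - M c) / (c - s) + D c.
Proof.
move=> c0 cs.
have h : J c 0 = \int[mu]_x (expR (- c * x) * J c x).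
  by rewrite /Rintegral -fubiniA.
rewrite mulrBl mul1r {1}h.
under eq_Rintegral do rewrite decomp//.
rewrite RintegralD//; [|exact: integrable_expAs|exact: integrableKmu].
rewrite RintegralD//; last 2 first.
  exact: (integrableZr _ _ (integrable_exp c (ltW c0))).
  exact: (integrableZr _ _ (integrable_expB c c0)).
rewrite !RintegralZr//; [|exact: integrable_expB|exact: integrable_exp (ltW _)].
rewrite RintegralB//; [|exact: integrable_exp (ltW _)|exact: integrable_exp (ltW _)].
rewrite !RME ?ltW// /D; ring.
Qed.

(* On steps above [- delta] the weights at [q] and [r] differ by a factor
   close to 1; the other steps are left to the indicator term. *)
Let K_compare q r delta x : 0 < q -> q < r -> 0 < delta ->
  K q x <= K r x <= K q x + (r - q) * delta * K r x +
    \1_`]-oo, - delta[ x * expR (- (s + r + 1) * x).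
Proof.
move=> q0 qr d0.
have r0 : 0 < r by exact: lt_trans qr.
have iKq := integrableK q x (ltW q0).
have iKr := integrableK r x (ltW r0).
apply/andP; split.
  apply: le_Rintegral => // z; rewrite /= in_itv/= => /andP[xz _].
  rewrite ler_wpM2r// ler_expR; apply: ler_wpM2r; last exact: ltW.
  by rewrite subr_ge0 ltW.
rewrite indicE mem_setE in_itv/=.
have [xd|xd] := ltP x (- delta); last first.
  rewrite mul0r addr0 -lerBlDr.
  have -> : K r x - (r - q) * delta * K r x =
      \int[leb]_(z in `]x, 0]) ((1 - (r - q) * delta) * (expR (r * (z - x)) * w z)).
    by rewrite RintegralZl//; rewrite -/(K r x); ring.
  apply: le_Rintegral => //; first exact: (integrableZl _ _ iKr).
  move=> z; rewrite /= in_itv/= => /andP[xz z0].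
  rewrite mulrA ler_wpM2r//.
  (* Here z - x <= - x <= delta, and 1 + u <= e^u at u = (q - r) (z - x) yields the factor 1 - (r -
     q) delta. *)
  have -> : expR (q * (z - x)) = expR ((q - r) * (z - x)) * expR (r * (z - x)).
    by rewrite -expRD; congr expR; ring.
  rewrite ler_wpM2r ?expR_ge0//.
  apply: le_trans (expR_ge1Dx _).
  rewrite lerD2l -(opprB r q) mulNr lerN2 ler_wpM2l//; lra.
(* Below - delta, [K r x] is at most - x e^(- (r + s) x); absorbing - x <= e^(- x) is the origin of
   the 1 in [s + r + 1]. *)
rewrite mul1r; apply: (@le_trans _ _ (expR (- (s + r + 1) * x))); last first.
  rewrite -[leLHS]add0r lerD// addr_ge0// mulr_ge0// mulr_ge0//; last exact: ltW.
  by rewrite subr_ge0 ltW.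
apply: (@le_trans _ _ (\int[leb]_(z in `]x, 0]) (expR (- r * x) * expR (- s * x)))).
  apply: le_Rintegral => //.
    have h : leb.-integrable `]x, 0] (fun z =>
        (expR (- r * x) * expR (- s * x))%:E * (EFin \o (fun z => expR (0 * z))) z)%E.
      by apply: integrableZl => //; exact: integrable_expRM.
    by apply: eq_integrable h => // z _ /=; rewrite mul0r expR0 mule1.
  move=> z; rewrite /= in_itv/= => /andP[xz z0].
  apply: ler_pM => //.
    by rewrite ler_expR mulNr -mulrN ler_wpM2l ?(ltW r0)//; lra.
  rewrite lerBlDr ler_wpDr//; first by have /andP[] := U01 z.
  by rewrite ler_expR !mulNr lerN2 ler_wpM2l// ltW.
rewrite Rintegral_cst//= lebesgue_measure_itv/= lte_fin.
have -> : x < 0 by lra.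
rewrite /= sub0r -expRD.
have -> : expR (- (s + r + 1) * x) = expR (- r * x + - s * x) * expR (- x).
  by rewrite -expRD; congr expR; ring.
rewrite ler_wpM2l ?expR_ge0//.
by apply: le_trans (expR_ge1Dx _); rewrite lerDr.
Qed.

(** By [balance] at [q] the quantity inside the norm is [D q - D r]: at [r] the left-hand side of
    [balance] vanishes and leaves D(r) = (M(s) - 1) / (s - r). Integrating [K_compare] over the step
    law bounds the difference. *)
Lemma one_step_estimate q r delta : 0 < q -> q < r -> q != s -> r != s ->
  0 < delta -> M r = 1 ->
  `|(1 - M q) * \int[leb]_(z in `]-oo, 0]) (expR (q * z) * U z)
    - (M s - M q) / (q - s) - (M s - 1) / (s - r)| <=
  (r - q) * delta * ((M s - 1) / (s - r)) +
    \int[mu]_(x in `]-oo, - delta[) expR (- (s + r + 1) * x).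
Proof.
move=> q0 qr qs rs d0 Mr.
have r0 : 0 < r by exact: lt_trans qr.
have Dr : D r = (M s - 1) / (s - r).
  have := balance r r0 rs; rewrite Mr subrr mul0r => /esym/eqP.
  rewrite addrC addr_eq0 => /eqP ->.
  by rewrite -(opprB s r) invrN mulrN opprK.
rewrite -/(J q 0) balance// -Dr (addrC _ (D q)) addrK.
have iq := integrableKmu q q0 qs.
have ir := integrableKmu r r0 rs.
have it : mu.-integrable setT
    (EFin \o (fun x => \1_`]-oo, - delta[ x * expR (- (s + r + 1) * x))).
  have h : 0 <= s + r + 1 by rewrite !addr_ge0// ltW.
  apply: le_integrable (integrable_exp _ h) => //.
    apply/measurable_EFinP; apply: measurable_funM.
      exact: measurable_indic.
    exact: measurable_expRM.
  move=> x _; rewrite /= lee_fin !ger0_norm ?mulr_ge0 ?expR_ge0//.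
  by rewrite ler_piMl ?expR_ge0// indicE lern1 leq_b1.
rewrite distrC ger0_norm; last first.
  rewrite subr_ge0; apply: (le_Rintegral measurableT iq ir) => x _.
  by have /andP[] := K_compare q r delta x q0 qr d0.
rewrite lerBlDl addrA.
have -> : \int[mu]_(x in `]-oo, - delta[) expR (- (s + r + 1) * x) =
    \int[mu]_x (\1_`]-oo, - delta[ x * expR (- (s + r + 1) * x)).
  rewrite Rintegral_mkcond; apply: eq_Rintegral => x _.
  by rewrite patchE indicE; case: ifP; rewrite (mul1r, mul0r).
have irZ : mu.-integrable setT (EFin \o (fun x => (r - q) * delta * K r x)).
  exact: (integrableZl _ _ ir).
have iqr := integrableD measurableT iq irZ.
rewrite -(RintegralZl _ measurableT ir) -(RintegralD measurableT iq irZ).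
rewrite -(RintegralD measurableT iqr it).
apply: (le_Rintegral measurableT ir (integrableD measurableT iqr it)) => x _.
by have /andP[] := K_compare q r delta x q0 qr d0.
Qed.

End one_step.

(** * Random walks stopped above zero *)

(** Rectangles are stable under intersection and generate the product sigma-algebra, so they
    determine a finite measure. *)
Lemma eq_measure_rectangle d1 d2 (T1 : measurableType d1) (T2 : measurableType d2)
    (R : realType) (m1 m2 : {measure set (T1 * T2) -> \bar R}) :
  (m1 setT < +oo)%E ->
  (forall A B, measurable A -> measurable B -> m1 (A `*` B) = m2 (A `*` B)) ->
  forall G, measurable G -> m1 G = m2 G.
Proof.
move=> m1oo m12 G mG.
pose C : set (set (T1 * T2)) := [set A `*` B | A in measurable & B in measurable].
apply: (measure_unique C (fun=> setT)) => //.
- exact: measurable_prod_measurableType.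
- move=> _ _ [A mA [B mB <-]] [A' mA' [B' mB' <-]].
  exists (A `&` A'); first exact: measurableI.
  exists (B `&` B'); first exact: measurableI.
  by rewrite setXI.
- by move=> _; exists setT => //; exists setT => //; rewrite setXTT.
- by rewrite bigcup_const//; exists 0%N.
- by move=> _ [A mA [B mB <-]]; exact: m12.
Qed.

Section stopped_walk.
Context d (T : measurableType d) (R : realType) (P : probability T R).
Variables (X : nat -> {RV P >-> R}) (mu : probability R R).
Hypothesis XE : forall (n : nat) (B : nat -> set R),
  (forall i, measurable (B i)) ->
  P [set w | forall i, (i < n)%N -> B i (X i w)] = (\prod_(i < n) mu (B i))%E.

(** The walk freezes at its first strictly positive position. Started from - y, this matches the
    strict inequality [y < xi t w] of first passage. *)
Fixpoint stopped_walk (x : R) (n : nat) (w : T) : R :=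
  if n is k.+1 then
    stopped_walk x k w + (if 0 < stopped_walk x k w then 0 else X k w)
  else x.

Let move (zx : R * R) : R := zx.1 + (if 0 < zx.1 then 0 else zx.2).

Let mmove : measurable_fun setT move.
Proof.
apply: measurable_funD => //.
apply: measurable_fun_ifT => //.
by apply: measurable_fun_ltr.
Qed.

Lemma measurable_stopped_walk x n : measurable_fun setT (stopped_walk x n).
Proof.
elim: n => [|n ih] //=.
rewrite (_ : (fun w => _) = move \o (fun w => (stopped_walk x n w, X n w)))//.
apply: measurableT_comp; first exact: mmove.
exact: measurable_fun_pair.
Qed.

Let future (n m : nat) (B : nat -> set R) :=
  [set w | forall i, (i < m)%N -> B i (X (n + i)%N w)].

Let mfuture n m B : (forall i, measurable (B i)) -> measurable (future n m B).
Proof.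
move=> mB; rewrite (_ : future n m B = \bigcap_(i in [set i | (i < m)%N]) X (n + i)%N @^-1` B i)//.
apply: bigcap_measurableType => i _.
by rewrite -[_ @^-1` _]setTI; exact: measurable_funP.
Qed.

Let joint x n (w : T) := (stopped_walk x n w, X n w).

Let mjoint x n : measurable_fun setT (joint x n).
Proof.
by apply: measurable_fun_pair => //; exact: measurable_stopped_walk.
Qed.

Let c (m : nat) (B : nat -> set R) := (\prod_(i < m) mu (B i))%E.

(** Induction invariant: the position at time [n] is independent of the next [m] steps. It is needed
    for all [m] at once, since advancing [n] consumes one future step. *)
Let indep x n := forall m B C, (forall i, measurable (B i)) -> measurable C ->
  P ((stopped_walk x n @^-1` C) `&` future n m B) =
  (P (stopped_walk x n @^-1` C) * c m B)%E.

(** On a rectangle the claim is the invariant with one more future step. Uniqueness of measures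
    extends it to every measurable [G], in particular to preimages under [move], which are not
    rectangles. *)
Let indep_joint x n : indep x n -> forall m B G, (forall i, measurable (B i)) ->
   measurable G ->
   P ((joint x n @^-1` G) `&` future n.+1 m B) = (P (joint x n @^-1` G) * c m B)%E.
Proof.
move=> ih m B G mB mG.
pose jm := isMeasurableFun.Build _ _ _ _ _ (mjoint x n).
pose J : {mfun T >-> (R * R)%type} := HB.pack (joint x n) jm.
have c_fin : c m B \is a fin_num.
  by apply: prode_fin_num => i _; apply: fin_num_measure.
have c_ge0 : (0 <= fine (c m B))%R by rewrite fine_ge0// prode_ge0.
pose r := NngNum c_ge0.
have cE : (c m B = r%:num%:E)%E by rewrite fineK.
pose m0 : {measure set (R * R) -> \bar R} :=
  pushforward (mrestr P (mfuture n.+1 m B mB)) J.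
pose m1 := m0 (mjoint x n).
pose m2 : {measure set (R * R) -> \bar R} := mscale r (distribution P J).
rewrite muleC cE.
have : m1 G = m2 G; last by [].
apply: eq_measure_rectangle mG => //.
  rewrite /m1 /m0 /pushforward/= /mrestr; apply: le_lt_trans (ltry 1).
  apply: probability_le1; apply: measurableI; last exact: mfuture.
  by rewrite -[_ @^-1` _]setTI; exact: mjoint.
move=> A B' mA mB'.
transitivity (P ((stopped_walk x n @^-1` A) `&`
    future n m.+1 (fun i => if i is k.+1 then B k else B'))).
  congr (P _); apply/seteqP; split => w /=.
    move=> [[Aw Bw] fw]; split => // -[|i] im; first by rewrite addn0.
    by rewrite addnS -addSn; exact: fw.
  move=> [Aw fw]; split; first split => //.
    by have := fw 0%N isT; rewrite /= addn0.
  by move=> i im; have := fw i.+1 im; rewrite addnS -addSn.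
rewrite ih//; last by case.
rewrite /c big_ord_recl/= muleA.
have := ih 1%N (fun=> B') A (fun=> mB') mA.
rewrite /c big_ord_recl big_ord0 mule1 => <-.
rewrite muleC /m2 /mscale/= -cE; congr (_ * P _)%E.
apply/seteqP; split => w /=.
  by move=> [Aw /(_ 0%N isT)]; rewrite addn0.
by move=> [Aw Bw]; split => // i; rewrite ltnS leqn0 => /eqP ->; rewrite addn0.
Qed.

Let indepP x n : indep x n.
Proof.
elim: n => [|n ih] m B C mB mC.
- have [xC|xC] := pselect (C x).
    rewrite (_ : _ @^-1` _ = setT); last by apply/seteqP; split.
    rewrite setTI probability_setT mul1e /c -XE//.
  rewrite (_ : _ @^-1` _ = set0); last by apply/seteqP; split.
  by rewrite set0I measure0 mul0e.
- apply: (indep_joint x n ih m B (move @^-1` C)) => //.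
  by rewrite -[_ @^-1` _]setTI; exact: mmove.
Qed.

Let indep_joint1 x n A B : measurable A -> measurable B ->
  P (joint x n @^-1` (A `*` B)) = (P (stopped_walk x n @^-1` A) * mu B)%E.
Proof.
move=> mA mB.
have := indepP x n 1 (fun=> B) A (fun=> mB) mA.
rewrite /c big_ord_recl big_ord0 mule1 => <-.
congr (P _); apply/seteqP; split => w /=.
  by move=> [Aw Bw]; split => // i; rewrite ltnS leqn0 => /eqP ->; rewrite addn0.
by move=> [Aw /(_ 0%N isT)]; rewrite addn0.
Qed.

(** The transition operator of the stopped walk. *)
Definition walk_step (F : R -> \bar R) (z : R) : \bar R :=
  if 0 < z then F z else (\int[mu]_x F (z + x)%R)%E.

Lemma measurable_walk_step F : measurable_fun setT F -> (forall z, 0 <= F z)%E ->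
  measurable_fun setT (walk_step F).
Proof.
move=> mF F0; apply: measurable_fun_ifT => //.
  exact: measurable_fun_ltr.
pose f (zx : R * R) := F (zx.1 + zx.2)%R.
apply: (measurable_fun_fubini_tonelli_F f) => //.
- by apply: measurableT_comp => //; exact: measurable_funD.
- by move=> zx; exact: F0.
Qed.

Lemma walk_step_ge0 F : (forall z, 0 <= F z)%E -> forall z, (0 <= walk_step F z)%E.
Proof.
by move=> F0 z; rewrite /walk_step; case: ifP => // _; apply: integral_ge0.
Qed.

Let walk_stepE F z : walk_step F z = (\int[mu]_x F (move (z, x)))%E.
Proof.
rewrite /walk_step /move/=; case: ifP => _; last by [].
by rewrite addr0 integral_cst// [X in (_ * X)%E](probability_setT mu) mule1.
Qed.

(** The joint law of the position and the next step is a product measure, so Fubini turns the last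
    step of the walk into one application of [walk_step] to [F]. The induction peels off that step
    and therefore runs over all [F]. *)
Lemma expectation_stopped_walk x n F : measurable_fun setT F ->
  (forall z, 0 <= F z)%E ->
  (\int[P]_w F (stopped_walk x n w))%E = iter n walk_step F x.
Proof.
elim: n F => [|n ih] F mF F0.
  by rewrite [LHS]/= (integral_cst P measurableT (F x)) [X in (_ * X)%E](probability_setT P) mule1.
rewrite iterSr -ih; first last.
- exact: walk_step_ge0.
- exact: measurable_walk_step.
pose jm := isMeasurableFun.Build _ _ _ _ _ (mjoint x n).
pose J : {RV P >-> (R * R)%type} := HB.pack (joint x n) jm.
pose vm := isMeasurableFun.Build _ _ _ _ _ (measurable_stopped_walk x n).
pose V : {RV P >-> R} := HB.pack (stopped_walk x n) vm.
transitivity ((\int[distribution P J]_zx F (move zx))%E).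
  rewrite ge0_integral_distribution//.
  exact: (measurableT_comp mF mmove).
transitivity ((\int[distribution P V \x mu]_zx F (move zx))%E).
  apply: eq_measure_integral => G mG _; apply/esym.
  apply: product_measure_unique => // A B mA mB.
  exact: indep_joint1.
rewrite (fubini_tonelli1 (F \o move) (measurableT_comp mF mmove)
  (fun zx => F0 (move zx))).
transitivity ((\int[distribution P V]_z walk_step F z)%E).
  by apply: eq_integral => z _; rewrite walk_stepE.
rewrite ge0_integral_distribution//.
- exact: measurable_walk_step.
- exact: walk_step_ge0.
Qed.

End stopped_walk.

(** * The exit transform as a fixed point of the transition operator *)

Section exit_value.
Context {R : realType} (mu : probability R R) (s : R).
Hypothesis s_gt0 : 0 < s.

(** Positions that have not left ]-oo, 0] count for 0, so the iterates of [walk_step] increase to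
    the transform of the exit position restricted to the walks that do exit. *)
Definition exit_cost (z : R) : R := if 0 < z then expR (- s * z) else 0.

Lemma exit_cost_ge0 z : 0 <= exit_cost z.
Proof. by rewrite /exit_cost; case: ifP => // _; exact: expR_ge0. Qed.

Lemma exit_cost_le1 z : exit_cost z <= 1.
Proof.
rewrite /exit_cost; case: ifP => // z0.
by rewrite -expR0 ler_expR mulNr oppr_le0 mulr_ge0 ?ltW.
Qed.

Lemma measurable_exit_cost : measurable_fun setT exit_cost.
Proof.
apply: measurable_fun_ifT => //; first exact: measurable_fun_ltr.
by apply: measurableT_comp => //; exact: mulrl_measurable.
Qed.

Let W n := iter n (walk_step R mu) (EFin \o exit_cost).

Let W_ge0 n z : (0 <= W n z)%E.
Proof.
elim: n z => [|n ih] z /=; first by rewrite lee_fin exit_cost_ge0.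
exact: walk_step_ge0.
Qed.

Let mW n : measurable_fun setT (W n).
Proof.
elim: n => [|n ih] /=; first by apply/measurable_EFinP; exact: measurable_exit_cost.
by apply: measurable_walk_step => //; exact: W_ge0.
Qed.

Let mWD n z : measurable_fun setT (fun x : R => W n (z + x)).
Proof. by apply: (measurableT_comp (mW n)); exact: measurable_funD. Qed.

Let W_le1 n z : (W n z <= 1)%E.
Proof.
elim: n z => [|n ih] z /=; first by rewrite lee_fin exit_cost_le1.
rewrite /walk_step; case: ifP => // _.
apply: (@le_trans _ _ (\int[mu]_x (cst 1 x))%E).
  by apply: ge0_le_integral => //.
by rewrite integral_cst// mul1e [leLHS](probability_setT mu).
Qed.

(** One step can only raise [exit_cost], which is 0 on z <= 0; monotonicity of [walk_step]
    propagates this. *)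
Let W_nd z : {homo (W ^~ z) : m n / (m <= n)%N >-> (m <= n)%E}.
Proof.
apply/nondecreasing_seqP => n; elim: n z => [|n ih] z.
  rewrite /= /walk_step /exit_cost/=; case: ifP => // _.
  by apply: integral_ge0 => x _; rewrite lee_fin; exact: exit_cost_ge0.
change (walk_step R mu (W n) z <= walk_step R mu (W n.+1) z)%E.
rewrite /walk_step; case: ifP => _; first exact: ih.
by apply: ge0_le_integral => //.
Qed.

(** [U] is the increasing limit of the iterates. Its mean value relation on z <= 0 is monotone
    convergence in the recursion from [W n] to [W n.+1]. The first four clauses are the hypotheses
    on [U] in the one-step identity. *)
Lemma exit_valueP : exists U : R -> R,
  [/\ measurable_fun setT U, (forall z, 0 <= U z <= 1),
    (forall z, 0 < z -> U z = expR (- s * z)),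
    (forall z, z <= 0 -> (U z)%:E = (\int[mu]_x (U (z + x))%:E)%E) &
    forall z, W n z @[n --> \oo] --> (U z)%:E].
Proof.
have cW z : cvgn (W ^~ z) by apply: ereal_nondecreasing_is_cvgn; exact: W_nd.
have L0 z : (0 <= limn (W ^~ z))%E by apply: lime_ge => //; exact: nearW.
have L1 z : (limn (W ^~ z) <= 1)%E by apply: lime_le => //; exact: nearW.
have Lfin z : limn (W ^~ z) \is a fin_num.
  by rewrite ge0_fin_numE// (le_lt_trans (L1 z)) ?ltry.
have mL : measurable_fun setT (fun z => limn (W ^~ z)).
  by apply: emeasurable_fun_cvg mW _ => z _; exact: cW.
exists (fun z => fine (limn (W ^~ z))).
have WL z : W n z @[n --> \oo] --> (fine (limn (W ^~ z)))%:E.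
  by rewrite fineK//; exact: cW.
have Wpos z : 0 < z -> forall n, W n z = (expR (- s * z))%:E.
  move=> z0; elim=> [|n ih] /=; first by rewrite /exit_cost z0.
  by rewrite /walk_step z0.
split => //.
- by apply: measurableT_comp => //; exact: fine_measurable.
- by move=> z; rewrite -!lee_fin fineK// L0 L1.
- move=> z z0; apply/EFin_inj; rewrite fineK//.
  apply: cvg_lim => //.
  rewrite (_ : W ^~ z = cst (expR (- s * z))%:E); first exact: cvg_cst.
  by apply/funext => n; exact: Wpos.
- move=> z z0; rewrite fineK//.
  under eq_integral do rewrite fineK//.
  rewrite monotone_convergence//.
  apply/esym/cvg_lim => //.
  rewrite (_ : (fun n => _) = (fun n => W n.+1 z)); last first.
    by apply/funext => n; rewrite /= /walk_step ltNge z0.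
  by rewrite (cvg_shiftS (W ^~ z)); exact: cW.
Qed.

End exit_value.

(** * The Levy process on a dyadic grid *)

Section paths.
Context {R : realType}.
Implicit Types x : R -> R.

Definition mesh (m : nat) : R := (2 ^+ m)^-1.

Lemma mesh_gt0 m : 0 < mesh m.
Proof. by rewrite invr_gt0 exprn_gt0. Qed.

Lemma cvg_mesh0 : mesh m @[m --> \oo] --> 0.
Proof.
rewrite (_ : mesh = (fun m => (2^-1) ^+ m)); last first.
  by apply/funext => m; rewrite /mesh exprVn.
by apply: cvg_expr; rewrite ger0_norm ?invr_ge0// invf_lt1// ltr1n.
Qed.

Lemma cvg_mesh : mesh m @[m --> \oo] --> 0^'+.
Proof.
move=> A [e /= e0 h]; have /cvgrPdist_lt/(_ e e0) := cvg_mesh0.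
by apply: filterS => m hm; apply: h => //; exact: mesh_gt0.
Qed.

Lemma right_cvg_le x t e : x u @[u --> t^'+] --> x t -> 0 < e ->
  exists2 r, 0 < r & forall u, t <= u -> u < t + r -> `|x t - x u| < e.
Proof.
move=> /cvgrPdist_lt h e0; have [r /= r0 hr] := h e e0.
exists r => // u; rewrite le_eqVlt => /predU1P[->|tu] ur; first by rewrite subrr normr0.
by apply: hr => //=; rewrite ltr0_norm; lra.
Qed.

Lemma left_cvg_lt x t l e : x u @[u --> t^'-] --> l -> 0 < e ->
  exists2 r, 0 < r & forall u, u < t -> t - r < u -> `|l - x u| < e.
Proof.
move=> /cvgrPdist_lt h e0; have [r /= r0 hr] := h e e0.
by exists r => // u ut ur; apply: hr => //=; rewrite gtr0_norm; lra.
Qed.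

(** Near a time [t] the path is close to its left limit before [t] and close to [x t] after it. The
    left limit is at most [x t], so crossing [t] cannot cost more than delta. Compactness of [0, 1]
    makes the window uniform in [t]. *)
Lemma cadlag_no_big_drop x delta : cadlag x ->
  (forall t, 0 < t -> lim (x u @[u --> t^'-]) <= x t) -> 0 < delta ->
  \forall eta \near 0^'+, forall a b, 0 <= a <= 1 -> a <= b -> b < a + eta ->
    x a - delta <= x b.
Proof.
move=> [xr xl] xJ d0.
suff : \forall eta \near 0^'+, `[0, 1]%classic `<=`
    [set a | forall b, 0 <= a -> a <= b -> b < a + eta -> x a - delta <= x b].
  apply: filterS => eta h a b /andP[a0 a1] ab bae.
  by apply: (h a) => //=; rewrite in_itv/= a0.
have /compact_near_coveringP := @segment_compact R 0 1.
apply => t; rewrite /= in_itv/= => /andP[t0 t1].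
have d20 : 0 < delta / 2 by rewrite divr_gt0.
have [r r0 hr] := right_cvg_le _ _ _ (xr t t0) d20.
have [e e0 he] : exists2 e, 0 < e & forall a b, 0 <= a -> a <= b ->
    t - e < a -> b < t + e -> x a - delta <= x b.
  have hright a b : t <= a -> a <= b -> b < t + r -> x a - delta <= x b.
    move=> ta ab br.
    have := hr a ta (le_lt_trans ab br); have := hr b (le_trans ta ab) br.
    by rewrite !ltr_norml; lra.
  move: t0; rewrite le_eqVlt => /predU1P[t0|t0].
    by exists r => // a b a0 ab _ br; apply: hright => //; rewrite -t0.
  have [l l0 hl] := left_cvg_lt _ _ _ _ (xl t t0) d20.
  exists (Num.min r l) => [|a b a0 ab]; first by rewrite lt_min r0.
  rewrite ltrBlDr -ltrBlDl lt_min => /andP[_ al].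
  rewrite -ltrBlDl lt_min => /andP[br _].
  have [ta|at_] := leP t a; first by apply: hright => //; lra.
  have := hl a at_ ltac:(lra).
  have [tb|bt] := leP t b.
    have := hr b tb ltac:(lra); have := xJ t t0.
    by rewrite !ltr_norml; lra.
  have := hl b bt ltac:(lra).
  by rewrite !ltr_norml; lra.
(* Halving [e] leaves room for both points: [a] within e / 2 of [t], and [b] less than e / 2 after
   [a]. *)
exists (ball t (e / 2), [set eta | 0 < eta < e / 2]).
  split => /=; first by apply: nbhsx_ballx; rewrite divr_gt0.
  exists (e / 2) => /=; first by rewrite divr_gt0.
  by move=> u /=; rewrite sub0r normrN => + u0; rewrite gtr0_norm// u0.
move=> [a eta] /= []; rewrite /ball/= ltr_distl => aP /andP[eta0 etae] b a0 ab bae.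
by apply: he => //; lra.
Qed.

Lemma mesh_no_big_drop x delta : cadlag x ->
  (forall t, 0 < t -> lim (x u @[u --> t^'-]) <= x t) -> 0 < delta ->
  \forall m \near \oo, forall k, (k < 2 ^ m)%N ->
    - delta <= x (k.+1%:R * mesh m) - x (k%:R * mesh m).
Proof.
move=> cx xJ d0.
(* The window is twice the mesh because the bound on [b] is strict and consecutive grid points are
   exactly one mesh apart. *)
have h1 : \forall m \near \oo, forall a b, 0 <= a <= 1 -> a <= b ->
    b < a + 2 * mesh m -> x a - delta <= x b.
  have h := cadlag_no_big_drop _ _ cx xJ d0.
  have c2 : 2 * mesh m @[m --> \oo] --> 0^'+.
    move=> A [e /= e0 hA]; have /cvgrPdist_lt/(_ (e / 2)) := cvg_mesh0.
    rewrite divr_gt0// => /(_ isT); apply: filterS => m hm.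
    have m0 := mesh_gt0 m; apply: hA => /=; last by rewrite mulr_gt0.
    by move: hm; rewrite !sub0r !normrN !gtr0_norm ?mulr_gt0//; lra.
  exact: (c2 _ h).
apply: filterS h1 => m h k km.
have m0 := mesh_gt0 m.
rewrite lerBrDl -[_ + - _]/(_ - _); apply: h.
- apply/andP; split; first by rewrite mulr_ge0// ltW.
  rewrite /mesh ler_pdivrMr ?exprn_gt0// mul1r.
  by rewrite -natrX ler_nat ltnW.
- by rewrite ler_pM2r// ler_nat.
- by rewrite -natr1 mulrDl mul1r ltrD2l; lra.
Qed.

End paths.

(** The inequality 1 + u <= e^u at u = mesh * a and at its opposite traps the quotient between a and
    a / (1 - mesh * a). *)
Lemma cvg_mesh_expR (R : realType) (a : R) :
  (mesh m)^-1 * (expR (mesh m * a) - 1) @[m --> \oo] --> a.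
Proof.
have c0 : mesh m * a @[m --> \oo] --> (0 : R).
  by rewrite -(mul0r a); apply: cvgMl; exact: cvg_mesh0.
have c1 : a / (1 - mesh m * a) @[m --> \oo] --> a.
  rewrite -[X in _ --> X]divr1 -[X in _ / X]subr0.
  apply: cvgMr; apply: cvgV; first by rewrite subr0 oner_neq0.
  by apply: cvgB => //; exact: cvg_cst.
apply: (squeeze_cvgr _ (cvg_cst a) c1).
have : \forall m \near \oo, mesh m * a < 1 by exact: (cvgr_lt 0 c0).
apply: filterS => m ma; have m0 := @mesh_gt0 R m.
apply/andP; split.
  rewrite mulrC ler_pdivlMr// lerBrDl mulrC; exact: expR_ge1Dx.
have n0 : 0 < 1 - mesh m * a by rewrite subr_gt0.
rewrite mulrC ler_pdivrMr// mulrAC ler_pdivlMr//.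
have h : expR (mesh m * a) * (1 - mesh m * a) <= 1.
  rewrite -ler_pdivlMl ?expR_gt0// mulr1 -expRN.
  by rewrite -mulrN; exact: expR_ge1Dx.
by rewrite mulrBl mul1r; move: h; rewrite (mulrC a); lra.
Qed.

Section levy_skeleton.
Context d (T : measurableType d) (R : realType) (P : probability T R).
Variables (xi : R -> {RV P >-> R}) (psi : R -> R).
Hypothesis xi_levy : levy_process xi.
Hypothesis psiE : is_laplace_exponent xi psi.

Definition increment (m k : nat) : {RV P >-> R} :=
  xi (k.+1%:R * mesh m) \- xi (k%:R * mesh m).

(** [xi 0] is subtracted because it is 0 only almost surely, and stationarity is stated for
    increments. *)
Definition increment_law (m : nat) : probability R R :=
  distribution P (xi (mesh m) \- xi 0 : {RV P >-> R}).

Lemma increment_indep m n (B : nat -> set R) : (forall i, measurable (B i)) ->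
  P [set w | forall i, (i < n)%N -> B i (increment m i w)] =
  (\prod_(i < n) increment_law m (B i))%E.
Proof.
move=> mB; have [_ _ indep stat] := xi_levy.
have m0 := ltW (@mesh_gt0 R m).
rewrite (indep n (fun k => k%:R * mesh m) B)//; last 2 first.
- by rewrite mul0r.
- by move=> i _; rewrite ler_wpM2r// ler_nat.
apply: eq_bigr => i _.
rewrite -natr1 mulrDl mul1r (stat _ _ (B i))//.
by rewrite mulr_ge0.
Qed.

(** Since [psi c] is a real number, the moment generating function is neither 0 nor +oo, the values
    at which [lne] is infinite. *)
Lemma laplace_exponentE t c : 0 <= c -> 0 < t ->
  (\int[P]_w (expR (- c * xi t w))%:E)%E = (expR (t * psi c))%:E.
Proof.
move=> c0 t0.
have ME : (\int[P]_w (expR (- c * xi t w))%:E)%E = 'M_P (xi t) (- c).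
  by rewrite /mmt_gen_fun unlock; apply: eq_integral => w _ /=; rewrite mulrC.
have : (0 <= 'M_P (xi t) (- c))%E.
  by rewrite -ME; apply: integral_ge0 => w _; rewrite lee_fin expR_ge0.
have := psiE c t c0 t0; rewrite ME.
case: ('M_P (xi t) (- c)%R) => [r||] //; last first.
  by rewrite /= gt0_muley// lte_fin invr_gt0.
rewrite lee_fin /=; case: ifPn => [_|]; first by rewrite gt0_muleNy// lte_fin invr_gt0.
rewrite -ltNge => r0 [->] _.
by rewrite mulrA divff ?gt_eqF// mul1r lnK.
Qed.

Lemma increment_law_laplace m c : 0 <= c ->
  (\int[increment_law m]_x (expR (- c * x))%:E)%E = (expR (mesh m * psi c))%:E.
Proof.
move=> c0; have [xi0 _ _ _] := xi_levy.
rewrite /increment_law ge0_integral_distribution//; last first.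
  by apply/measurable_EFinP; exact: measurable_expRM.
rewrite -(laplace_exponentE (mesh m) c c0 (mesh_gt0 m)).
apply: ge0_ae_eq_integral => //=.
- apply/measurable_EFinP; apply: (measurableT_comp (measurable_expRM (- c))).
  exact: measurable_funB.
- by apply/measurable_EFinP; apply: (measurableT_comp (measurable_expRM (- c))).
by apply: filterS xi0 => w /= -> _; rewrite subr0.
Qed.

(** Let p be the probability that one increment falls below - delta. By independence (1 - p)^(2^m)
    is the probability that none of the 2^m increments on [0, 1] does so. It tends to 1, because
    each path without negative jumps eventually has no such increment. Finally 1 - p <= e^(- p)
    bounds 2^m p by - ln ((1 - p)^(2^m)). *)
Lemma increment_law_drop (delta : R) : no_negative_jumps xi -> 0 < delta ->
  (mesh m)^-1 * fine (increment_law m `]-oo, - delta[%classic) @[m --> \oo] --> 0.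
Proof.
move=> nojump d0; have [_ xi_cadlag _ _] := xi_levy.
set A := `]-oo, - delta[%classic.
have mA : measurable A by exact: measurable_itv.
pose p m := fine (increment_law m A).
have pE m : increment_law m A = (p m)%:E.
  by rewrite /p fineK//; apply: fin_num_measure.
have p_ge0 m : 0 <= p m by rewrite fine_ge0.
pose G m := [set w | forall i, (i < 2 ^ m)%N -> (~` A) (increment m i w)].
have mG m : measurable (G m).
  rewrite (_ : G m = \bigcap_(i in [set i | (i < 2 ^ m)%N]) increment m i @^-1` (~` A))//.
  apply: bigcap_measurableType => i _.
  rewrite -[_ @^-1` _]setTI; apply: measurable_funP => //; exact: measurableC.
have PG m : P (G m) = ((1 - p m) ^+ (2 ^ m))%:E.
  rewrite /G (increment_indep m _ (fun=> ~` A)); last first.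
    by move=> _; exact: measurableC.
  under eq_bigr do rewrite probability_setC// pE -EFinB.
  by rewrite prodEFin prodr_const card_ord.
have PG1 : P (G m) @[m --> \oo] --> 1%E.
  have : (\int[P]_w (\1_(G m) w)%:E)%E @[m --> \oo] --> (\int[P]_w (cst 1 w))%E.
    have hm m : measurable_fun setT (fun w => (\1_(G m) w : R)%:E).
      by apply/measurable_EFinP; exact: measurable_indic.
    have hcv : {ae P, forall w, setT w ->
        (\1_(G m) w : R)%:E @[m --> \oo] --> (cst 1%E w : \bar R)}.
      apply: filterS nojump => w hw _; apply: cvg_near_cst.
      have := mesh_no_big_drop _ delta (xi_cadlag w) hw d0.
      apply: filterS => m hm'; rewrite indicE mem_set// => i im.
      by rewrite /A /= in_itv/= => /lt_geF; rewrite hm'.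
    have hb : {ae P, forall w, forall m, setT w ->
        (`|(\1_(G m) w : R)%:E| <= (cst 1%E w : \bar R))%E}.
      apply: aeW => w m _ /=; rewrite lee_fin indicE; case: (_ \in _) => /=.
        by rewrite normr1.
      by rewrite normr0.
    have [|_ _] := dominated_convergence measurableT hm (measurable_cst _) hcv _ hb.
      exact: finite_measure_integrable_cst.
    by [].
  rewrite integral_cst// mul1e [X in _ --> X -> _](probability_setT P).
  under eq_fun do rewrite integral_indic// setIT.
  by [].
have c1 : (1 - p m) ^+ (2 ^ m) @[m --> \oo] --> (1 : R).
  have /fine_cvgP[_] : P (G m) @[m --> \oo] --> (1 : R)%:E := PG1.
  rewrite (_ : fine \o _ = (fun m => (1 - p m) ^+ (2 ^ m)))//.
  by apply/funext => m /=; rewrite PG.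
have cln : - ln ((1 - p m) ^+ (2 ^ m)) @[m --> \oo] --> (0 : R).
  rewrite -oppr0 -(@ln1 R); apply: cvgN; apply: continuous_cvg c1.
  exact: continuous_ln.
apply: (squeeze_cvgr _ (cvg_cst 0) cln).
have : \forall m \near \oo, 0 < (1 - p m) ^+ (2 ^ m).
  by apply: (cvgr_gt 1 c1); exact: ltr01.
apply: filterS => m am; apply/andP; split.
  by apply: mulr_ge0; [rewrite invr_ge0 ltW// mesh_gt0|exact: p_ge0].
rewrite lerNr -ler_expR lnK// /mesh invrK.
rewrite -mulrN -natrX expRM_natl.
apply: lerXn2r; rewrite ?nnegrE ?expR_ge0//.
  by rewrite subr_ge0 -lee_fin -pE probability_le1.
exact: expR_ge1Dx.
Qed.

Let integrable_law m c : 0 <= c ->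
  (increment_law m).-integrable setT (EFin \o (fun x : R => expR (- c * x))).
Proof.
move=> c0; apply/integrableP; split.
  by apply/measurable_EFinP; exact: measurable_expRM.
under eq_integral do rewrite /= ger0_norm ?expR_ge0//.
by rewrite increment_law_laplace// ltry.
Qed.

Let RintegralE m c : 0 <= c ->
  \int[increment_law m]_x expR (- c * x) = expR (mesh m * psi c).
Proof. by move=> c0; rewrite /Rintegral increment_law_laplace. Qed.

(** With w = e^(- c x), the first bracket is the mean of (w - 1)^2, which is O(mesh) and carries the
    small factor [e]; the large constant 1 + 1 / (4 e) multiplies only the probability of the
    tail. *)
Let tail_le m (c delta e : R) : 0 < c -> 0 < e ->
  \int[increment_law m]_(x in `]-oo, - delta[) expR (- c * x) <=
  e * (expR (mesh m * psi (2 * c)) - 2 * expR (mesh m * psi c) + 1) +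
  (1 + (4 * e)^-1) * fine (increment_law m `]-oo, - delta[%classic).
Proof.
move=> c0 e0.
set A := `]-oo, - delta[%classic.
have mA : measurable A by exact: measurable_itv.
have c20 : 0 <= 2 * c by rewrite mulr_ge0// ltW.
have i0 : (increment_law m).-integrable setT
    (EFin \o (fun x : R => 2 * expR (- c * x))).
  exact: (integrableZl _ 2 (integrable_law m _ (ltW c0))).
have i1 : (increment_law m).-integrable setT (EFin \o (fun x : R => expR (- (2 * c) * x)
  - 2 * expR (- c * x))).
  exact: (integrableB _ (integrable_law m _ c20) i0).
have i2 : (increment_law m).-integrable setT (EFin \o cst (1 : R)).
  exact: finite_measure_integrable_cst.
have i3 := integrableD measurableT i1 i2.
have i4 : (increment_law m).-integrable setT (EFin \o (\1_A : R -> R)).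
  exact: integrable_indic.
rewrite Rintegral_mkcond.
have -> : e * (expR (mesh m * psi (2 * c)) - 2 * expR (mesh m * psi c) + 1) +
  (1 + (4 * e)^-1) * fine (increment_law m A) =
  \int[increment_law m]_x (e * (expR (- (2 * c) * x) - 2 * expR (- c * x) + 1)
     + (1 + (4 * e)^-1) * \1_A x).
  rewrite (RintegralD measurableT (integrableZl measurableT e i3)
    (integrableZl measurableT _ i4)).
  rewrite (RintegralZl e measurableT i3) (RintegralZl _ measurableT i4).
  rewrite (RintegralD measurableT i1 i2).
  rewrite (RintegralB measurableT (integrable_law m _ c20) i0).
  rewrite (RintegralZl 2 measurableT (integrable_law m _ (ltW c0))).
  rewrite !RintegralE ?(ltW c0)// Rintegral_cst// mul1r.
  congr (_ * (_ + _) + _ * _).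
    exact: (f_equal fine (esym (probability_setT (increment_law m)))).
  by rewrite /Rintegral integral_indic// setIT.
apply: le_Rintegral => //.
- rewrite -restrict_EFin; apply/integrable_restrict => //; rewrite setTI.
  by apply: integrableS (integrable_law m _ (ltW c0)).
- exact: (integrableD _ (integrableZl measurableT e i3) (integrableZl measurableT _ i4)).
move=> x _.
have -> : expR (- (2 * c) * x) = expR (- c * x) ^+ 2.
  by rewrite -expRM_natl; congr expR; ring.
rewrite patchE indicE; case: ifP => _; last first.
  rewrite mulr0 addr0 mulr_ge0 ?(ltW e0)//.
  rewrite (_ : _ + 1 = (expR (- c * x) - 1) ^+ 2); last by ring.
  exact: sqr_ge0.
rewrite mulr1 -subr_ge0; set w := expR _.
(* [w <= e (w - 1)^2 + 1 + 1 / (4 e)] *)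
rewrite (_ : _ - w = e * (w - 1 - (2 * e)^-1) ^+ 2).
  by rewrite mulr_ge0 ?sqr_ge0// ltW.
by field; rewrite gt_eqF.
Qed.

Lemma increment_law_tail c delta : no_negative_jumps xi -> 0 < c -> 0 < delta ->
  (mesh m)^-1 * \int[increment_law m]_(x in `]-oo, - delta[) expR (- c * x)
    @[m --> \oo] --> (0 : R).
Proof.
move=> nojump c0 d0.
apply/cvgrPdist_lt => eta eta0.
set L := psi (2 * c) - 2 * psi c.
have L0 : 0 < `|L| + 1 by rewrite ltr_pwDr.
(* The mean of (w - 1)^2 divided by the mesh tends to [L]; this [e] makes its contribution less than
   eta in the limit. *)
pose e := eta / 2 / (`|L| + 1).
have e0 : 0 < e by rewrite !divr_gt0.
pose b m := e * ((mesh m)^-1 * (expR (mesh m * psi (2 * c)) - 1) -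
      2 * ((mesh m)^-1 * (expR (mesh m * psi c) - 1))) +
    (1 + (4 * e)^-1) *
      ((mesh m)^-1 * fine (increment_law m `]-oo, - delta[%classic)).
have cb : b m @[m --> \oo] --> e * L + (1 + (4 * e)^-1) * 0.
  apply: cvgD.
    apply: cvgMr; apply: cvgB; first exact: cvg_mesh_expR.
    by apply: cvgMr; exact: cvg_mesh_expR.
  by apply: cvgMr; exact: increment_law_drop.
have Leta : e * L + (1 + (4 * e)^-1) * 0 < eta.
  rewrite mulr0 addr0; apply: (@le_lt_trans _ _ (e * (`|L| + 1))).
    by rewrite ler_pM2l// (le_trans (ler_norm L))// lerDl.
  by rewrite /e divfK ?gt_eqF// ltr_pdivrMr// ltr_pMr// ltr1n.
have hb : \forall m \near \oo, b m < eta by exact: (cvgr_lt _ cb).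
apply: filterS hb => m hm.
have m0 := @mesh_gt0 R m.
rewrite sub0r normrN ger0_norm; last first.
  rewrite mulr_ge0 ?invr_ge0 ?(ltW m0)//.
  by apply: Rintegral_ge0 => x _; exact: expR_ge0.
apply: le_lt_trans hm; rewrite /b; have := tail_le m c delta e c0 e0.
rewrite -(ler_pM2l (_ : 0 < (mesh m)^-1)) ?invr_gt0// => /le_trans; apply.
by rewrite le_eqVlt; apply/orP; left; apply/eqP; ring.
Qed.

End levy_skeleton.

(** * First passage *)

Section first_exceed.
Context {R : realType}.
Implicit Types (a : nat -> R) (F : R -> R).

(** A search over the [n] indices from [j] on, with default [D]. It is started at [j = 1], because
    first passage asks for a strictly positive time. *)
Fixpoint first_exceed a F (D : R) (j n : nat) : R :=
  if n is k.+1 then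
    if 0 < a j then F (a j) else first_exceed a F D j.+1 k
  else D.

Lemma first_exceed_none a F D j n : (forall k, (j <= k)%N -> a k <= 0) ->
  first_exceed a F D j n = D.
Proof.
elim: n j => [//|n ih] j aj /=; rewrite ltNge aj//= ih// => k jk.
by rewrite aj// ltnW.
Qed.

Lemma first_exceedE a F D j n N : (forall k, (j <= k < N)%N -> a k <= 0) ->
  0 < a N -> (j <= N < j + n)%N -> first_exceed a F D j n = F (a N).
Proof.
elim: n j => [|n ih] j aj aN; first by rewrite addn0 => /andP[/leq_ltn_trans h /h]; rewrite ltnn.
move=> /andP[+ Njn] /=; rewrite leq_eqVlt => /predU1P[->|jN]; first by rewrite aN.
rewrite ltNge aj ?leqnn//= ih//; last by rewrite jN addSnnS.
by move=> k /andP[jk kN]; rewrite aj// (ltnW jk).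
Qed.

Lemma cvg_first_exceed_none a F D : (forall k, (0 < k)%N -> a k <= 0) ->
  first_exceed a F D 1 n @[n --> \oo] --> D.
Proof.
move=> aD; apply: cvg_near_cst; apply: nearW => n.
by rewrite first_exceed_none.
Qed.

Lemma cvg_first_exceed a F D N : (forall k, (0 < k < N)%N -> a k <= 0) ->
  0 < a N -> (0 < N)%N -> first_exceed a F D 1 n @[n --> \oo] --> F (a N).
Proof.
move=> aj aN N0; apply: cvg_near_cst; exists N => // n /= Nn.
by rewrite (first_exceedE _ _ _ _ _ N)// N0 add1n ltnS.
Qed.

Lemma is_cvg_first_exceed a F D : cvgn (first_exceed a F D 1).
Proof.
have [[N [N0 aN]]|aN] := pselect (exists N, (0 < N)%N /\ 0 < a N).
  have h : exists N, (0 < N)%N && (0 < a N) by exists N; rewrite N0.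
  apply/cvg_ex; exists (F (a (ex_minn h))).
  case: ex_minnP => n /andP[n0 an] nmin; apply: cvg_first_exceed => //.
  move=> k /andP[k0 kn]; rewrite leNgt; apply/negP => ak.
  by have := nmin k; rewrite k0 ak leqNgt kn => /(_ isT).
apply/cvg_ex; exists D; apply: cvg_first_exceed_none => k k0.
by rewrite leNgt; apply/negP => ak; apply: aN; exists k.
Qed.

End first_exceed.

Section passage.
Context {R : realType}.
Implicit Types (x F : R -> R).

Definition grid_excess x (y : R) (m k : nat) : R := x (k%:R * mesh m) - y.

Definition passes x (y : R) : Prop := exists t, 0 < t /\ y < x t.

Definition passage_time x (y : R) : R := inf [set t : R | 0 < t /\ y < x t].

(* On a path that never exceeds [y] the junk value [inf set0 = 0] of the passage
   time plays no role: the payoff is then [D]. *)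
Definition passage_payoff x (y : R) F (D : R) : R :=
  if `[< passes x y >] then F (x (passage_time x y) - y) else D.

(** The first grid time above [y] is never before the infimum [tau]. It is also not much later: a
    time [t] of passage close to [tau] is followed, by right continuity at [t], by a grid time still
    above [y]. Right continuity at [tau] concludes. *)
Lemma cvg_passage_payoff x y F D : cadlag x -> continuous F ->
  limn (first_exceed (grid_excess x y m) F D 1) @[m --> \oo] -->
  passage_payoff x y F D.
Proof.
move=> [xr _] cF; rewrite /passage_payoff; case: asboolP => [xy|xy]; last first.
  apply: cvg_near_cst; apply: nearW => m; apply/cvg_lim => //.
  apply: cvg_first_exceed_none => k k0; rewrite subr_le0 leNgt; apply/negP => yx.
  by apply: xy; exists (k%:R * mesh m); rewrite mulr_gt0 ?ltr0n// mesh_gt0.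
set A := [set t : R | 0 < t /\ y < x t].
set tau := passage_time x y.
have A0 : A !=set0 by case: xy => t tA; exists t.
have lbA : lbound A 0 by move=> t [/ltW].
have hA : has_inf A by split => //; exists 0.
have tau0 : 0 <= tau by exact: lb_le_inf.
have cG : F (x u - y) @[u --> tau^'+] --> F (x tau - y).
  apply: (@cvg_comp _ _ _ (fun u => x u - y) F _ (nbhs (x tau - y))); last exact: cF.
  by apply: cvgB; [exact: xr|exact: cvg_cst].
apply/cvgrPdist_lt => eta eta0.
have [r r0 hr] := right_cvg_le (fun u => F (x u - y)) tau eta cG eta0.
have [t [t0 yt] tr] : exists2 t, A t & t < tau + r by exact: inf_adherent.
have [r' r'0 hr'] := right_cvg_le x t (x t - y) (xr t (ltW t0)) (ltac:(lra)).
have h1 : \forall m \near \oo, mesh m < Num.min r' (tau + r - t).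
  have := @cvg_mesh0 R; move=> /(cvgr_lt 0); apply.
  by rewrite lt_min r'0; lra.
apply: filterS h1 => m; rewrite lt_min => /andP[m1 m2].
have m0 := @mesh_gt0 R m.
(* [k] indexes the first grid time strictly after [t]. *)
pose k := (Num.truncn (t / mesh m)).+1.
have [k1 k2] : t < k%:R * mesh m /\ k%:R * mesh m <= t + mesh m.
  have /truncn_itv/andP[k1 k2] : 0 <= t / mesh m by rewrite divr_ge0// ltW.
  split; first by rewrite -ltr_pdivrMr.
  by rewrite /k -natr1 mulrDl mul1r lerD2r -ler_pdivlMr.
have xk : 0 < grid_excess x y m k.
  have := hr' (k%:R * mesh m) (ltW k1) ltac:(lra).
  by rewrite /grid_excess ltr_distlC; lra.
have hN : exists N, (0 < N)%N && (0 < grid_excess x y m N) by exists k; rewrite xk.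
have [N /andP[N0 xN] Nmin] := ex_minnP hN.
have -> : limn (first_exceed (grid_excess x y m) F D 1) = F (grid_excess x y m N).
  apply/cvg_lim => //; apply: cvg_first_exceed => // j /andP[j0 jN].
  rewrite leNgt; apply/negP => xj.
  by have := Nmin j; rewrite j0 xj leqNgt jN => /(_ isT).
have Nk : (N <= k)%N by apply: Nmin; rewrite xk.
apply: hr.
  apply: ge_inf => //; first by exists 0.
  by split; [rewrite mulr_gt0 ?ltr0n|move: xN; rewrite /grid_excess subr_gt0].
apply: (@le_lt_trans _ _ (k%:R * mesh m)); last by lra.
by rewrite ler_wpM2r ?ler_nat// ltW.
Qed.

(** Otherwise right continuity would keep the path below [y] just after the passage time, against
    its being an infimum. *)
Lemma passage_overshoot_ge0 x y : cadlag x -> passes x y ->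
  0 <= x (passage_time x y) - y.
Proof.
move=> [xr _] [t0 t0A]; rewrite subr_ge0 leNgt; apply/negP => xty.
have hA : has_inf [set t : R | 0 < t /\ y < x t].
  by split; [exists t0|exists 0 => t [/ltW]].
have tau0 : 0 <= passage_time x y.
  by apply: lb_le_inf; [exists t0|move=> t [/ltW]].
have [r r0 hr] := right_cvg_le x _ (y - x (passage_time x y)) (xr _ tau0) (ltac:(lra)).
have [t tA tr] := inf_adherent r0 hA.
have := hr t (ge_inf hA.2 tA) tr.
by case: tA => _ yt; rewrite ltr_distl; lra.
Qed.

End passage.

(** Either no value up to time [n] is positive and the walk sits at [a n], or it is frozen at the
    first positive value; in the first case both sides are 0. *)
Lemma first_exceed_stopped_walk d (T : measurableType d) (R : realType)
    (P : probability T R) (X : nat -> {RV P >-> R}) (s : R) (a : nat -> R) n w :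
  a 0%N <= 0 -> (forall k, X k w = a k.+1 - a k) ->
  exit_cost s (stopped_walk _ _ _ P X (a 0%N) n w) =
  first_exceed a (fun z => expR (- s * z)) 0 1 n.
Proof.
move=> a0 Xa; set V := stopped_walk _ _ _ P X (a 0%N).
have : (forall k, (k <= n)%N -> a k <= 0) /\ V n w = a n \/
    exists N, [/\ (0 < N <= n)%N, (forall k, (k < N)%N -> a k <= 0), 0 < a N & V n w = a N].
  elim: n => [|n [[an Vn]|[N [/andP[N0 Nn] aN aN0 VN]]]].
  - by left; split => // k; rewrite leqn0 => /eqP ->.
  - have VS : V n.+1 w = a n.+1.
      change (V n w + (if 0 < V n w then 0 else X n w) = a n.+1).
      by rewrite Vn ltNge an//= Xa addrC subrK.
    have [an0|an0] := leP (a n.+1) 0.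
      by left; split => // k; rewrite leq_eqVlt => /predU1P[->//|]; exact: an.
    right; exists n.+1; split; [by rewrite leqnn| |by []|by []].
    by move=> k; rewrite ltnS; exact: an.
  - right; exists N; split => //; first by rewrite N0 ltnW.
    change (V n w + (if 0 < V n w then 0 else X n w) = a N).
    by rewrite VN aN0 addr0.
move=> [[an ->]|[N [/andP[N0 Nn] aN aN0 ->]]]; rewrite /exit_cost.
  rewrite ltNge an//=; apply/esym.
  have : forall j m, (j + m <= n.+1)%N -> first_exceed a (fun z => expR (- s * z)) 0 j m = 0.
    move=> j m; elim: m j => [//|m ih] j jm /=.
    rewrite ltNge an//=; last by rewrite -ltnS (leq_trans _ jm)// addnS ltnS leq_addr.
    by rewrite ih// addSnnS.
  by apply; rewrite add1n.
rewrite aN0 (first_exceedE _ _ _ _ _ N)//; last by rewrite N0 add1n ltnS.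
by move=> k /andP[_]; exact: aN.
Qed.

Section levy_passage.
Context d (T : measurableType d) (R : realType) (P : probability T R).
Variables (xi : R -> {RV P >-> R}) (s : R).
Hypothesis xi_levy : levy_process xi.
Hypothesis s_gt0 : 0 < s.

Let path w : R -> R := fun t => xi t w.

Let path_cadlag w : cadlag (path w).
Proof. by have [_ + _ _] := xi_levy; exact. Qed.

Lemma measurable_first_exceed (a : nat -> T -> R) F (D : T -> R) j n :
  (forall k, measurable_fun setT (a k)) -> measurable_fun setT F ->
  measurable_fun setT D ->
  measurable_fun setT (fun w => first_exceed (a ^~ w) F (D w) j n).
Proof.
move=> ma mF mD; elim: n j => [//|n ih] j /=.
apply: measurable_fun_ifT => //; first exact: measurable_fun_ltr.
by apply: (measurableT_comp mF).
Qed.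

Let mexcess y m k : measurable_fun setT (fun w => grid_excess (path w) y m k).
Proof. by apply: measurable_funB => //; exact: measurable_funP. Qed.

Let mlimn y m F D : measurable_fun setT F -> measurable_fun setT D ->
  measurable_fun setT (fun w => limn (first_exceed (grid_excess (path w) y m) F (D w) 1)).
Proof.
move=> mF mD.
apply: (@measurable_fun_cvg _ _ _ _ (fun n w =>
  first_exceed (grid_excess (path w) y m) F (D w) 1 n)) => //.
  by move=> n; apply: measurable_first_exceed => // k; exact: mexcess.
by move=> w _; exact: is_cvg_first_exceed.
Qed.

Lemma measurable_passage_payoff y F D : continuous F -> measurable_fun setT D ->
  measurable_fun setT (fun w => passage_payoff (path w) y F (D w)).
Proof.
move=> cF mD.
have mF : measurable_fun setT F by exact: continuous_measurable_fun.
apply: (@measurable_fun_cvg _ _ _ _ (fun m w =>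
  limn (first_exceed (grid_excess (path w) y m) F (D w) 1))) => //.
  by move=> m; exact: mlimn.
by move=> w _; exact: cvg_passage_payoff.
Qed.

Let e (z : R) := expR (- s * z).

Let ce : continuous e.
Proof. exact: continuous_expRM. Qed.

Definition passage_transform (y : R) : R :=
  \int[P]_w passage_payoff (path w) y e 0.

Let first_exceed_e a n : 0 <= first_exceed a e 0 1 n <= 1.
Proof.
move: 1%N => j; elim: n j => [|n ih] j /=; first by rewrite lexx ler01.
case: ifP => // aj; rewrite expR_ge0/= -expR0 ler_expR mulNr oppr_le0.
by rewrite mulr_ge0// ltW.
Qed.

Let limn_e a : 0 <= limn (first_exceed a e 0 1) <= 1.
Proof.
have c := is_cvg_first_exceed a e 0.
apply/andP; split; [apply: limr_ge => //|apply: limr_le => //]; apply: nearW => n;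
  by have /andP[] := first_exceed_e a n.
Qed.

Let payoff_e w y : 0 <= passage_payoff (path w) y e 0 <= 1.
Proof.
rewrite /passage_payoff; case: asboolP => [wy|_]; last by rewrite lexx ler01.
have := passage_overshoot_ge0 _ _ (path_cadlag w) wy.
by rewrite /e expR_ge0/= -expR0 ler_expR mulNr oppr_le0 => ?; rewrite mulr_ge0// ltW.
Qed.

Lemma passage_transformE y :
  (passage_transform y)%:E = (\int[P]_w (passage_payoff (path w) y e 0)%:E)%E.
Proof.
rewrite /passage_transform /Rintegral fineK//.
have mp : measurable_fun setT (fun w => passage_payoff (path w) y e 0).
  by apply: measurable_passage_payoff => //; exact: measurable_cst.
apply: integrable_fin_num => //; apply: measurable_bounded_integrable => //.
  by rewrite [X in (X < _)%E](probability_setT P) ltry.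
exists 1; split => // z z1 w _ /=; rewrite ger0_norm; last by case/andP: (payoff_e w y).
by apply: (le_trans _ (ltW z1)); case/andP: (payoff_e w y).
Qed.

(** Two limits, both dominated by 1. At a fixed mesh, letting [n] grow identifies [U m (- y)] with
    the mean payoff at the first grid passage; refining the mesh then gives the payoff at the true
    passage time. *)
Lemma cvg_exit_value y (U : nat -> R -> R) : 0 <= y ->
  (forall m z, iter n (walk_step R (increment_law _ _ _ _ xi m)) (EFin \o exit_cost s) z
     @[n --> \oo] --> (U m z)%:E) ->
  U m (- y) @[m --> \oo] --> passage_transform y.
Proof.
move=> y0 UE.
have mexp : measurable_fun setT (exit_cost s) by exact: measurable_exit_cost.
have mfirst m n : measurable_fun setT
    (fun w => first_exceed (grid_excess (path w) y m) e 0 1 n).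
  apply: measurable_first_exceed => //; first by move=> k; exact: mexcess.
  exact: measurable_expRM.
have UmE m : (U m (- y))%:E =
    (\int[P]_w (limn (first_exceed (grid_excess (path w) y m) e 0 1))%:E)%E.
  apply: (cvg_unique _ (UE m (- y))) => //=.
  have [xi0 _ _ _] := xi_levy.
  have -> : (fun n => iter n (walk_step R (increment_law _ _ _ _ xi m))
      (EFin \o exit_cost s) (- y)) =
      (fun n => \int[P]_w (first_exceed (grid_excess (path w) y m) e 0 1 n)%:E)%E.
    apply/funext => n.
    rewrite -(expectation_stopped_walk _ _ _ P (increment _ _ _ P xi m)) //; last 3 first.
    - move=> k B mB; exact: increment_indep.
    - by apply/measurable_EFinP.
    - by move=> z; rewrite lee_fin exit_cost_ge0.
    apply: ge0_ae_eq_integral => //.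
    - apply/measurable_EFinP; apply: (measurableT_comp mexp).
      exact: measurable_stopped_walk.
    - apply/measurable_EFinP; exact: mfirst.
    - by move=> w _; rewrite lee_fin exit_cost_ge0.
    - by move=> w _; rewrite lee_fin; case/andP: (first_exceed_e (grid_excess (path w) y m) n).
    apply: filterS xi0 => w xi0 _ /=; congr EFin.
    rewrite -(first_exceed_stopped_walk _ _ _ P (increment _ _ _ P xi m) s
      (grid_excess (path w) y m) n w)//.
    + by rewrite /grid_excess /path mul0r xi0 sub0r.
    + by rewrite /grid_excess /path mul0r xi0 sub0r oppr_le0.
    + by move=> k; rewrite /grid_excess /increment/= opprB addrA subrK.
  apply: (@dominated_cvg _ _ _ P _ measurableT _ _ (cst 1%E)) => //.
  - by move=> n; apply/measurable_EFinP; exact: mfirst.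
  - move=> w _; apply: cvg_EFin; first exact: nearW.
    exact: is_cvg_first_exceed.
  - exact: finite_measure_integrable_cst.
  - move=> n w _; rewrite lee_fin ger0_norm;
      by case/andP: (first_exceed_e (grid_excess (path w) y m) n).
have mlim m : measurable_fun setT
    (fun w => limn (first_exceed (grid_excess (path w) y m) e 0 1)).
  by apply: mlimn => //; exact: measurable_expRM.
have : (U m (- y))%:E @[m --> \oo] --> (passage_transform y)%:E.
  under eq_fun do rewrite UmE.
  rewrite passage_transformE.
  apply: (@dominated_cvg _ _ _ P _ measurableT _ _ (cst 1%E)) => //.
  - by move=> m; apply/measurable_EFinP.
  - move=> w _; apply: cvg_EFin; first exact: nearW.
    exact: cvg_passage_payoff.
  - exact: finite_measure_integrable_cst.
  - move=> m w _; rewrite lee_fin ger0_norm;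
      by case/andP: (limn_e (grid_excess (path w) y m)).
by move/fine_cvgP => [_].
Qed.

(** On a path that never exceeds [y], [first_passage] is 0 and the overshoot is [xi 0 w - y], almost
    surely - y. The absolute value turns its contribution into e^(- s y), and it changes nothing on
    the other paths, where the overshoot is nonnegative. *)
Lemma passage_transform_overshoot y : 0 < y ->
  exists2 b : R, 0 <= b <= expR (- s * y) &
  ('E_P[fun w => expR (- s * `|overshoot xi y w|)] = (passage_transform y + b)%:E)%E.
Proof.
move=> y0; have [xi0 _ _ _] := xi_levy.
pose F (z : R) := expR (- s * `|z|).
have cF : continuous F.
  move=> z; apply: (@continuous_comp _ _ _ (fun z : R => `|z|) e); last exact: ce.
  exact: norm_continuous.
have F01 z : 0 <= F z <= 1.
  by rewrite expR_ge0/= -expR0 ler_expR mulNr oppr_le0 mulr_ge0// ltW.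
pose D w := F (xi 0 w - y).
have mD : measurable_fun setT D.
  have mF : measurable_fun setT F by exact: continuous_measurable_fun.
  apply: (measurableT_comp mF).
  exact: measurable_funB.
pose g w := passage_payoff (path w) y F (D w).
have gE : (fun w => expR (- s * `|overshoot xi y w|)) = g.
  apply/funext => w; rewrite /g /passage_payoff; case: asboolP => // wy.
  rewrite /D /F /overshoot /first_passage.
  rewrite (_ : [set t : R | 0 < t /\ y < xi t w] = set0) ?inf0//.
  by apply/seteqP; split => // t tA; apply: wy; exists t.
have mg : measurable_fun setT g by exact: measurable_passage_payoff.
have bounded_int (f : T -> R) : measurable_fun setT f -> (forall w, 0 <= f w <= 1) ->
    P.-integrable setT (EFin \o f).
  move=> mf f01; apply: measurable_bounded_integrable => //.
    by rewrite [X in (X < _)%E](probability_setT P) ltry.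
  exists 1; split => // z z1 w _ /=; have /andP[f0 f1] := f01 w.
  by rewrite ger0_norm// (le_trans f1)// ltW.
have mp : measurable_fun setT (fun w => passage_payoff (path w) y e 0).
  by apply: measurable_passage_payoff => //; exact: measurable_cst.
have ip := bounded_int _ mp (fun w => payoff_e w y).
have iD := bounded_int _ mD (fun w => F01 _).
have g01 w : 0 <= g w <= 1 by rewrite /g /passage_payoff; case: ifP => _; exact: F01.
have ig := bounded_int _ mg g01.
have pg w : passage_payoff (path w) y e 0 <= g w <= passage_payoff (path w) y e 0 + D w.
  rewrite /g /passage_payoff; case: asboolP => [wy|_].
    have h := passage_overshoot_ge0 _ _ (path_cadlag w) wy.
    by rewrite /F ger0_norm// lexx/= lerDl; case/andP: (F01 (xi 0 w - y)).
  by rewrite add0r lexx andbT; case/andP: (F01 (xi 0 w - y)).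
have DE : \int[P]_w D w = expR (- s * y).
  rewrite /Rintegral (_ : \int[P]_w (D w)%:E = (expR (- s * y))%:E)%E//.
  transitivity ((\int[P]_w (cst (expR (- s * y))%:E) w)%E).
    apply: ge0_ae_eq_integral => //.
    - by apply/measurable_EFinP.
    - by move=> w _; rewrite lee_fin expR_ge0.
    - by move=> w _; rewrite lee_fin expR_ge0.
    apply: filterS xi0 => w xi0 _ /=; congr EFin.
    by rewrite /D /F xi0 sub0r normrN gtr0_norm.
  by rewrite integral_cst// [X in (_ * X)%E](probability_setT P) mule1.
exists (\int[P]_w g w - passage_transform y).
  rewrite subr_ge0 lerBlDl -DE /passage_transform -RintegralD//.
  apply/andP; split; apply: le_Rintegral => //.
  - by move=> w _; case/andP: (pg w).
  - exact: (integrableD measurableT ip iD).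
  - by move=> w _; case/andP: (pg w).
rewrite addrC subrK gE unlock /Rintegral fineK//.
exact: integrable_fin_num.
Qed.

End levy_passage.

(** * The Laplace transform of the stationary overshoot *)

Section wiener_hopf.
Context d (T : measurableType d) (R : realType) (P : probability T R).
Variables (xi : R -> {RV P >-> R}) (psi : R -> R) (s : R).
Hypothesis xi_levy : levy_process xi.
Hypothesis xi_nojump : no_negative_jumps xi.
Hypothesis psiE : is_laplace_exponent xi psi.
Hypothesis s_gt0 : 0 < s.
Local Notation leb := (@lebesgue_measure R).
Local Notation f := (passage_transform _ _ _ P xi s).

Let U := projT1 (choice (fun m => exit_valueP (increment_law _ _ _ _ xi m) s s_gt0)).

Let UP m : [/\ measurable_fun setT (U m), (forall z, 0 <= U m z <= 1),
    (forall z, 0 < z -> U m z = expR (- s * z)),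
    (forall z, z <= 0 ->
      (U m z)%:E = (\int[increment_law _ _ _ _ xi m]_x (U m (z + x))%:E)%E) &
    forall z, iter n (walk_step R (increment_law _ _ _ _ xi m)) (EFin \o exit_cost s) z
      @[n --> \oo] --> (U m z)%:E].
Proof. exact: (projT2 (choice (fun m => exit_valueP (increment_law _ _ _ _ xi m) s s_gt0))). Qed.

Let cvg_U y : 0 <= y -> U m (- y) @[m --> \oo] --> f y.
Proof.
move=> y0; apply: cvg_exit_value => //.
by move=> m z; have [_ _ _ _] := UP m.
Qed.

Lemma passage_transform01 y : 0 <= y -> 0 <= f y <= 1.
Proof.
move=> y0; have c := cvg_U y y0.
apply/andP; split.
  apply: (@ler_cvg_to _ _ _ _ (cst 0) (fun m => U m (- y)) _ _ (cvg_cst _) c); apply: nearW => m.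
  by have [_ /(_ (- y))/andP[]] := UP m.
apply: (@ler_cvg_to _ _ _ _ (fun m => U m (- y)) (cst 1) _ _ c (cvg_cst _)); apply: nearW => m.
by have [_ /(_ (- y))/andP[]] := UP m.
Qed.

Lemma measurable_passage_transform : measurable_fun (`]-oo, 0]%classic : set R) (fun z : R => f (- z)).
Proof.
apply: (@measurable_fun_cvg _ _ _ _ (fun m z => U m z)) => //.
  by move=> m; apply: measurable_funTS; have [] := UP m.
move=> z; rewrite /= in_itv/= => z0.
by have := cvg_U (- z); rewrite oppr_ge0 opprK; exact.
Qed.

(** A(q) of the limiting process, in the reflected variable. *)
Definition passage_laplace (q : R) : R :=
  \int[leb]_(z in `]-oo, 0]) (expR (q * z) * f (- z)).

Let mexp (q : R) : measurable_fun (`]-oo, 0]%classic : set R) (fun z : R => expR (q * z)).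
Proof. by apply: measurable_funTS; exact: measurable_expRM. Qed.

Let iexp (q : R) : 0 < q -> leb.-integrable `]-oo, 0] (EFin \o (fun z : R => expR (q * z))).
Proof.
move=> q0; apply/integrableP; split; first by apply/measurable_EFinP; exact: mexp.
under eq_integral do rewrite /= ger0_norm ?expR_ge0//.
by rewrite integral_expRNy// ltry.
Qed.

Lemma integrable_passage_laplace (q : R) : 0 < q ->
  leb.-integrable `]-oo, 0] (EFin \o (fun z : R => expR (q * z) * f (- z))).
Proof.
move=> q0; apply: le_integrable (iexp q q0) => //.
  apply/measurable_EFinP; apply: measurable_funM; first exact: mexp.
  exact: measurable_passage_transform.
move=> z; rewrite /= in_itv/= => z0.
have /andP[f0 f1] : 0 <= f (- z) <= 1 by rewrite passage_transform01// oppr_ge0.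
by rewrite lee_fin !ger0_norm ?mulr_ge0 ?expR_ge0// ler_piMr ?expR_ge0.
Qed.

Let cvg_J (q : R) : 0 < q ->
  \int[leb]_(z in `]-oo, 0]) (expR (q * z) * U m z) @[m --> \oo] -->
  passage_laplace q.
Proof.
move=> q0.
have : (\int[leb]_(z in `]-oo, 0%R]) (expR (q * z) * U m z)%:E @[m --> \oo] -->
   \int[leb]_(z in `]-oo, 0%R]) (expR (q * z) * f (- z))%:E)%E.
  apply: (@dominated_cvg _ _ _ leb _ _ _ _ (EFin \o (fun z : R => expR (q * z)))) => //.
  - move=> m; apply/measurable_EFinP; apply: measurable_funM; first exact: mexp.
    by apply: measurable_funTS; have [] := UP m.
  - move=> z; rewrite /= in_itv/= => z0; apply: cvg_EFin; first exact: nearW.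
    by apply: cvgMr; have := cvg_U (- z); rewrite oppr_ge0 opprK; exact.
  - exact: iexp.
  - move=> m z _; have [_ /(_ z)/andP[U0 U1] _ _ _] := UP m.
    by rewrite lee_fin ger0_norm ?mulr_ge0 ?expR_ge0// ler_piMr ?expR_ge0.
rewrite (_ : (\int[leb]_(z in `]-oo, 0%R]) (expR (q * z) * f (- z))%:E)%E =
    (passage_laplace q)%:E); first by move/fine_cvg.
rewrite /passage_laplace /Rintegral fineK//; apply: integrable_fin_num => //.
exact: integrable_passage_laplace.
Qed.

(** [one_step_estimate] divided by the mesh. For fixed delta its tail term vanishes in the limit,
    which leaves a bound on the defect [L] proportional to delta; delta is then arbitrary. *)
Lemma passage_laplaceE q r : 0 < q -> q < r -> q != s -> r != s -> psi r = 0 ->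
  - psi q * passage_laplace q = (psi s - psi q) / (q - s) + psi s / (s - r).
Proof.
move=> q0 qr qs rs pr.
have r0 : 0 < r by exact: lt_trans qr.
set L := - psi q * passage_laplace q - (psi s - psi q) / (q - s) - psi s / (s - r).
suff L0 : L = 0.
  by apply/eqP; rewrite -subr_eq0 opprD addrA -/L L0.
pose M m c := expR (mesh m * psi c) : R.
pose J m := \int[leb]_(z in `]-oo, 0]) (expR (q * z) * U m z).
pose tl delta m := \int[increment_law _ _ _ _ xi m]_(x in `]-oo, - delta[)
  expR (- (s + r + 1) * x).
pose a m := (mesh m)^-1 *
  ((1 - M m q) * J m - (M m s - M m q) / (q - s) - (M m s - 1) / (s - r)).
pose b delta m := (r - q) * delta * ((mesh m)^-1 * (M m s - 1) / (s - r)) +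
  (mesh m)^-1 * tl delta m.
have est delta m : 0 < delta -> `|a m| <= b delta m.
  move=> d0; have [U1 U2 U3 U4 _] := UP m.
  have m0 : 0 < (mesh m)^-1 :> R by rewrite invr_gt0 mesh_gt0.
  rewrite /a /b normrM (ger0_norm (ltW m0)).
  have -> : (r - q) * delta * ((mesh m)^-1 * (M m s - 1) / (s - r)) + (mesh m)^-1 * tl delta m
    = (mesh m)^-1 * ((r - q) * delta * ((M m s - 1) / (s - r)) + tl delta m) by ring.
  rewrite ler_pM2l//.
  apply: (one_step_estimate (increment_law _ _ _ _ xi m) (U m) (M m) s) => //.
  - by move=> c c0; exact: increment_law_laplace.
  - by rewrite /M pr mulr0 expR0.
have cM c : (mesh m)^-1 * (M m c - 1) @[m --> \oo] --> psi c by exact: cvg_mesh_expR.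
have cL : a m @[m --> \oo] --> L.
  have -> : a = (fun m => - ((mesh m)^-1 * (M m q - 1)) * J m -
    ((mesh m)^-1 * (M m s - 1) - (mesh m)^-1 * (M m q - 1)) / (q - s) -
    (mesh m)^-1 * (M m s - 1) / (s - r)).
    by apply/funext => m; rewrite /a; ring.
  apply: cvgB; last by apply: cvgMl.
  apply: cvgB; last by apply: cvgMl; apply: cvgB.
  by apply: cvgM; [exact: cvgN|exact: cvg_J].
have Lle delta : 0 < delta -> `|L| <= (r - q) * delta * (psi s / (s - r)).
  move=> d0.
  have cb : b delta m @[m --> \oo] --> (r - q) * delta * (psi s / (s - r)).
    rewrite -[X in _ --> X]addr0; apply: cvgD.
      by apply: cvgMr; apply: cvgMl.
    apply: (increment_law_tail _ _ _ _ xi psi) => //.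
    by rewrite !addr_gt0.
  apply: (@ler_cvg_to _ _ _ _ (fun m => `|a m|) (b delta) _ _ (cvg_norm cL) cb).
  by apply: nearW => m; exact: est.
apply/eqP; rewrite -normr_le0; apply/ler_addgt0Pr => e e0; rewrite add0r.
set C := (r - q) * (psi s / (s - r)).
(* The sign of psi(s) / (s - r) is read off from the bound at delta = 1. *)
have C0 : 0 <= C.
  by have := le_trans (normr_ge0 L) (Lle 1 ltr01); rewrite mulr1.
have d0 : 0 < e / (C + 1) by rewrite divr_gt0// ltr_wpDl.
apply: (le_trans (Lle _ d0)).
rewrite (_ : _ * _ = C * e / (C + 1)); last by rewrite /C; ring.
by rewrite ler_pdivrMr ?ltr_wpDl// mulrC ler_pM2l// lerDl.
Qed.

End wiener_hopf.

(** * An Abelian theorem for exponentially weighted means *)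

Section abel.
Context {R : realType}.
Local Notation leb := (@lebesgue_measure R).

(** The weights q e^(q z) have total mass 1 on z <= 0. Beyond distance [Y0] the function is within e
    / 2 of its limit; up to [Y0] the difference is at most C = |l| + 1, and the mass there is at
    most q Y0. *)
Lemma abel_mean (f : R -> R) (l : R) :
  measurable_fun (`]-oo, 0]%classic : set R) (fun z : R => f (- z)) ->
  (forall y, 0 <= y -> 0 <= f y <= 1) -> f y @[y --> +oo] --> l ->
  q * \int[leb]_(z in `]-oo, 0]) (expR (q * z) * f (- z)) @[q --> 0^'+] --> l.
Proof.
move=> mf f01 fl; apply/cvgrPdist_lt => e e0.
have [Y [_ hY]] : \forall y \near +oo, `|l - f y| < e / 2.
  by move/cvgrPdist_lt : fl; apply; rewrite divr_gt0.
pose Y0 := `|Y| + 1.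
have Y00 : 0 < Y0 by rewrite /Y0 ltr_pwDr.
have YY0 : Y < Y0 by rewrite /Y0 (le_lt_trans (ler_norm Y))// ltrDl.
pose C := `|l| + 1.
have C0 : 0 < C by rewrite /C ltr_pwDr.
near=> q.
have q0 : 0 < q by near: q; exact: nbhs_right_gt.
have qs : q * (C * Y0) < e / 2.
  rewrite -ltr_pdivlMr ?mulr_gt0//; near: q; apply: nbhs_right_lt.
  by rewrite !divr_gt0// mulr_gt0.
have me : measurable_fun (`]-oo, 0]%classic : set R) (fun z : R => expR (q * z)).
  by apply: measurable_funTS; exact: measurable_expRM.
have ie : leb.-integrable `]-oo, 0] (EFin \o (fun z : R => expR (q * z))).
  apply/integrableP; split; first by apply/measurable_EFinP.
  under eq_integral do rewrite /= ger0_norm ?expR_ge0//.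
  by rewrite integral_expRNy// ltry.
have iF : leb.-integrable `]-oo, 0] (EFin \o (fun z : R => expR (q * z) * f (- z))).
  apply: le_integrable ie => //.
    by apply/measurable_EFinP; apply: measurable_funM.
  move=> z; rewrite /= in_itv/= => z0.
  have /andP[f0 f1] : 0 <= f (- z) <= 1 by rewrite f01// oppr_ge0.
  by rewrite lee_fin !ger0_norm ?mulr_ge0 ?expR_ge0// ler_piMr ?expR_ge0.
have il : leb.-integrable `]-oo, 0] (EFin \o (fun z : R => expR (q * z) * l)).
  by have := integrableZr _ l ie; exact.
have lE : l = q * \int[leb]_(z in `]-oo, 0]) (expR (q * z) * l).
  rewrite RintegralZr// /Rintegral integral_expRNy//= mulr0 expR0.
  by field; rewrite gt_eqF.
have idx : leb.-integrable `]-oo, 0] (EFin \o (\1_`]- Y0, 0] : R -> R)).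
  apply: (@integrableS _ _ _ _ setT) => //.
  exact: integrable_indic_itv.
have i1 : leb.-integrable `]-oo, 0] (EFin \o (fun z : R => expR (q * z) * (e / 2))).
  by have := integrableZr _ (e / 2) ie; exact.
have i2 : leb.-integrable `]-oo, 0] (EFin \o (fun z : R => C * \1_`]- Y0, 0] z)).
  by have := integrableZl _ C idx; exact.
have ig : leb.-integrable `]-oo, 0]
    (EFin \o (fun z : R => expR (q * z) * (e / 2) + C * \1_`]- Y0, 0] z)).
  by have := integrableD _ i1 i2; exact.
rewrite {1}lE -mulrBr -RintegralB// normrM (gtr0_norm q0).
apply: (@le_lt_trans _ _ (q * \int[leb]_(z in `]-oo, 0])
    (expR (q * z) * (e / 2) + C * \1_`]- Y0, 0] z))).
  rewrite ler_pM2l//.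
  have iB : leb.-integrable `]-oo, 0] (EFin \o
      (fun z : R => expR (q * z) * l - expR (q * z) * f (- z))).
    by have := integrableB _ il iF; exact.
  apply: (le_trans (le_normr_Rintegral _ iB)) => //.
  apply: le_Rintegral => //; first exact: integrable_norm.
  move=> z; rewrite /= in_itv/= => z0.
  rewrite -mulrBr normrM ger0_norm ?expR_ge0// indicE mem_setE in_itv/= z0 andbT.
  have [zY|zY] := ltP (- Y0) z.
    have /andP[f0 f1] : 0 <= f (- z) <= 1 by rewrite f01// oppr_ge0.
    rewrite mulr1 ler_wpDl// ?mulr_ge0 ?expR_ge0//; first lra.
    apply: (@le_trans _ _ (1 * C)); last by rewrite mul1r.
    apply: ler_pM => //.
      by rewrite -expR0 ler_expR pmulr_rle0.
    by rewrite /C (le_trans (ler_normB _ _))// lerD2l ger0_norm.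
  rewrite mulr0 addr0 ler_wpM2l ?expR_ge0// ltW// hY//; lra.
rewrite RintegralD//.
rewrite RintegralZr// RintegralZl//.
rewrite {1}/Rintegral integral_expRNy//= mulr0 expR0.
rewrite /Rintegral integral_indic//.
rewrite setIidl; last by move=> z /=; rewrite !in_itv/= => /andP[].
rewrite /= lebesgue_measure_itv/= lte_fin oppr_lt0 Y00/= sub0r opprK.
rewrite (_ : q * _ = e / 2 + q * (C * Y0)).
  by rewrite [ltRHS](splitr e) ltrD2l.
by field; rewrite gt_eqF.
Unshelve. all: by end_near.
Qed.

End abel.

(** * The slope of the Laplace exponent at zero *)

Section mean.
Context d (T : measurableType d) (R : realType) (P : probability T R).
Variables (X : {RV P >-> R}) (psi : R -> R) (gamma : R).
Hypothesis XE : forall c, 0 <= c ->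
  (\int[P]_w (expR (- c * X w))%:E)%E = (expR (psi c))%:E.
Hypothesis EX : ('E_P[X] = gamma%:E)%E.

Let mexp c : measurable_fun setT (fun w => (expR (- c * X w))%:E).
Proof.
apply/measurable_EFinP; apply: (measurableT_comp (measurable_expRM (- c))).
exact: measurable_funP.
Qed.

Let iexp c : 0 <= c -> P.-integrable setT (fun w => (expR (- c * X w))%:E).
Proof.
move=> c0; apply/integrableP; split; first exact: mexp.
under eq_integral do rewrite /= ger0_norm ?expR_ge0//.
by rewrite XE// ltry.
Qed.

(** The negative part is at most e^(- X), hence integrable; an infinite integral of the positive
    part would then contradict the finiteness of the mean. *)
Let iX : P.-integrable setT (EFin \o X).
Proof.
have mX : measurable_fun setT (EFin \o X) by apply/measurable_EFinP.
have iN : (\int[P]_w (EFin \o X)^\- w < +oo)%E.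
  apply: (@le_lt_trans _ _ (\int[P]_w (expR (- 1 * X w))%:E)%E); last first.
    by rewrite XE// ltry.
  apply: ge0_le_integral => //; first exact: measurable_funeneg.
  move=> w _; rewrite funenegE /= -EFin_max lee_fin mulN1r ge_max expR_ge0 andbT.
  by apply: le_trans (expR_ge1Dx _); rewrite lerDr.
apply/integrableP; split => //.
rewrite -[X in integral _ _ X]/(abse \o (EFin \o X)) fune_abse.
rewrite ge0_integralD//; [|exact: measurable_funepos|exact: measurable_funeneg].
have p0 : (0 <= \int[P]_w (EFin \o X)^\+ w)%E by apply: integral_ge0.
have n0 : (0 <= \int[P]_w (EFin \o X)^\- w)%E by apply: integral_ge0.
have : ((\int[P]_w (EFin \o X)^\+ w) - (\int[P]_w (EFin \o X)^\- w) = gamma%:E)%E.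
  by rewrite -integralE -EX unlock.
move: iN p0 n0; case: (\int[P]_w (EFin \o X)^\- w)%E => [b||]//.
by case: (\int[P]_w (EFin \o X)^\+ w)%E => [a||] // _ _ _ _; rewrite -EFinD ltry.
Qed.

(** For x >= 0 the quotient is at most x in absolute value. For x < 0, with t = mesh * (- x), it
    follows from e^t - 1 <= t e^t, mesh <= 1 and - x <= e^(- x). *)
Let mesh_quotient_bound m (x : R) :
  `|(mesh m)^-1 * (expR (mesh m * - x) - 1)| <= `|x| + expR (- 2 * x).
Proof.
have h0 := @mesh_gt0 R m.
have h1 : mesh m <= 1 :> R.
  by rewrite /mesh invf_le1 ?exprn_gt0// exprn_ege1// ler1n.
rewrite normrM gtr0_norm ?invr_gt0// mulrC ler_pdivrMr//.
have [x0|x0] := leP 0 x.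
  rewrite ler0_norm; last by rewrite subr_le0 -expR0 ler_expR mulrN oppr_le0 mulr_ge0// ltW.
  rewrite ger0_norm// opprB; have := expR_ge1Dx (mesh m * - x).
  have := mulr_ge0 (expR_ge0 (- 2 * x)) (ltW h0).
  by rewrite mulrDl; lra.
have nx0 : 0 < - x by rewrite oppr_gt0.
set t := mesh m * - x.
have t0 : 0 < t by rewrite mulr_gt0.
rewrite ger0_norm; last by rewrite subr_ge0 -expR0 ler_expR ltW.
have h2 : expR t - 1 <= t * expR t.
  have := ler_wpM2r (expR_ge0 t) (expR_ge1Dx (- t)).
  by rewrite expRN mulVf ?gt_eqF ?expR_gt0//; lra.
apply: (le_trans h2).
have h3 : expR t <= expR (- x) by rewrite ler_expR ler_piMl// ltW.
have h4 : - x * expR (- x) <= expR (- 2 * x).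
  have -> : expR (- 2 * x) = expR (- x) * expR (- x).
    by rewrite -expRD; congr expR; ring.
  rewrite ler_wpM2r ?expR_ge0//.
  by apply: le_trans (expR_ge1Dx _); rewrite lerDr.
apply: (@le_trans _ _ (mesh m * (- x * expR (- x)))).
  rewrite /t -mulrA ler_wpM2l ?(ltW h0)// ler_wpM2l// ltW//.
rewrite mulrC ler_wpM2r ?(ltW h0)//.
by apply: (le_trans h4); rewrite lerDr.
Qed.

(** Dominated convergence gives the limit for e^psi - 1 in place of psi; the inequalities (e^t - 1)
    / e^t <= t <= e^t - 1 transfer it to psi. *)
Lemma cvg_laplace_exponent_mean : (mesh m)^-1 * psi (mesh m) @[m --> \oo] --> - gamma.
Proof.
have EXE : (\int[P]_w (X w)%:E = gamma%:E)%E by rewrite -EX unlock.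
have c1 : (mesh m)^-1 * (expR (psi (mesh m)) - 1) @[m --> \oo] --> - gamma.
  have : (\int[P]_w ((mesh m)^-1 * (expR (mesh m * - X w) - 1))%:E @[m --> \oo] -->
      \int[P]_w (- X w)%:E)%E.
    apply: (@dominated_cvg _ _ _ P _ measurableT _ _
      (fun w => (`|X w| + expR (- 2 * X w))%:E)) => //.
    - move=> m; apply/measurable_EFinP; apply: measurable_funM => //.
      apply: measurable_funB => //; apply: (measurableT_comp (measurable_expRM (mesh m))).
      exact: measurable_funN.
    - by move=> w _; apply: cvg_EFin; [exact: nearW|exact: cvg_mesh_expR].
    - exact: (integrableD measurableT (integrable_norm iX) (iexp 2 (ler0n _ 2))).
    - by move=> m w _; rewrite lee_fin; exact: mesh_quotient_bound.
  have -> : (\int[P]_w (- X w)%:E)%E = (- gamma)%:E.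
    under eq_integral do rewrite EFinN.
    by rewrite integralN ?EXE//; exact: integrable_add_def.
  have -> : (fun m => \int[P]_w ((mesh m)^-1 * (expR (mesh m * - X w) - 1))%:E)%E =
      (fun m => ((mesh m)^-1 * (expR (psi (mesh m)) - 1))%:E).
    apply/funext => m; under eq_integral do rewrite mulrN -mulNr EFinM EFinB.
    have h0 := ltW (@mesh_gt0 R m).
    rewrite integralZl//; last first.
      by apply: integrableB => //; [exact: iexp|exact: finite_measure_integrable_cst].
    rewrite integralB//; [|exact: iexp|exact: finite_measure_integrable_cst].
    by rewrite XE// integral_cst// mul1e [X in (_ - X)%E](probability_setT P).
  by move/fine_cvg.
have c0 : expR (psi (mesh m)) @[m --> \oo] --> (1 : R).
  have -> : (fun m => expR (psi (mesh m))) =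
      (fun m => mesh m * ((mesh m)^-1 * (expR (psi (mesh m)) - 1)) + 1).
    by apply/funext => m; rewrite mulrA divff ?gt_eqF ?mesh_gt0// mul1r subrK.
  rewrite -[X in _ --> X]add0r; apply: cvgD; last exact: cvg_cst.
  by rewrite -(mul0r (- gamma)); apply: cvgM; [exact: cvg_mesh0|exact: c1].
have c2 : (mesh m)^-1 * (expR (psi (mesh m)) - 1) / expR (psi (mesh m))
    @[m --> \oo] --> - gamma.
  rewrite -[X in _ --> X]divr1; apply: cvgM; first exact: c1.
  by apply: cvgV => //; exact: oner_neq0.
apply: (squeeze_cvgr _ c2 c1); apply: nearW => m.
have m0 : 0 < (mesh m)^-1 :> R by rewrite invr_gt0 mesh_gt0.
rewrite -mulrA !ler_pM2l//; set t := psi _; apply/andP; split.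
  rewrite ler_pdivrMr ?expR_gt0//.
  have := expR_ge1Dx (- t); rewrite expRN => h.
  have := ler_wpM2r (expR_ge0 t) h.
  by rewrite mulVf ?gt_eqF ?expR_gt0//; lra.
by rewrite lerBrDl expR_ge1Dx.
Qed.

End mean.

(** * Laplace transforms of laws on the half-line *)

Section laplace_transform.
Context {R : realType} (rho : probability R R).
Let N : set R := [set` `]-oo, (0 : R)[].
Let B : set R := [set` `[(0 : R), +oo[].

Let mB : measurable B. Proof. exact: measurable_itv. Qed.
Let mN : measurable N. Proof. exact: measurable_itv. Qed.

(* The absolute value makes the function continuous on the whole line. *)
Definition laplace_abs (s : R) : R := \int[rho]_(z in B) expR (- (`|s| * z)).

Let mlap (s : R) : measurable_fun setT (fun z : R => expR (- (s * z))).
Proof.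
apply: (measurableT_comp (@measurable_expR R)); apply: measurable_funN.
exact: mulrl_measurable.
Qed.

Let ilap (s : R) : 0 <= s -> rho.-integrable B (EFin \o (fun z : R => expR (- (s * z)))).
Proof.
move=> s0; apply: measurable_bounded_integrable => //.
- by apply: (le_lt_trans (probability_le1 rho mB)); rewrite ltry.
- exact: measurable_funTS.
exists 1; split => // y y1 z; rewrite /B /= in_itv/= andbT => z0.
rewrite ger0_norm ?expR_ge0//; apply: (le_trans _ (ltW y1)).
by rewrite -expR0 ler_expR oppr_le0 mulr_ge0.
Qed.

Lemma laplace_transformE s : 0 <= s -> laplace_transform rho s = (laplace_abs s)%:E.
Proof.
move=> s0; rewrite /laplace_transform /laplace_abs /Rintegral ger0_norm// fineK//.
by apply: integrable_fin_num => //; exact: ilap.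
Qed.

Lemma continuous_laplace_abs : continuous laplace_abs.
Proof.
move=> x.
have := @continuity_under_integral R _ _ rho (fun s z => expR (- (`|s| * z))) B _ (x - 1) (x + 1).
move=> /(_ _ _ _ (cst 1)) h.
apply: h; rewrite ?mem_setE ?in_itv/=.
- exact: mB.
- by move=> s _; exact: (ilap `|s| (normr_ge0 s)).
- apply: aeW => z _ s _; apply: continuous_comp; last exact: continuous_expR.
  by apply: cvgN; apply: cvgMl; exact: norm_continuous.
- exact: finite_measure_integrable_cst.
- move=> s _; apply: aeW => z; rewrite /B /= in_itv/= andbT => z0.
  by rewrite ger0_norm ?expR_ge0// -expR0 ler_expR oppr_le0 mulr_ge0.
- by rewrite ltrBlDr ltrDl ltr01.
Qed.

Let dNB : N `&` B = set0.
Proof.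
by apply/seteqP; split => // z; rewrite /N /B /= !in_itv/= andbT => -[]; case: ltP.
Qed.

Let NBT : N `|` B = setT.
Proof.
apply/seteqP; split => // z _; rewrite /N /B /= !in_itv/= andbT.
by case: ltP; [left|right].
Qed.

Hypothesis rhoN : rho N = 0%E.

Let rhoB : rho B = 1%E.
Proof.
rewrite -(probability_setT rho) -NBT; apply/esym/(etrans (measureU rho mN mB dNB)).
by rewrite [X in (X + _)%E]rhoN add0e.
Qed.

(** A zero integral of a strictly positive function would make [0, +oo[ a null set, whereas it has
    mass 1. This positivity later excludes further roots of psi. *)
Lemma laplace_abs_gt0 s : 0 <= s -> 0 < laplace_abs s.
Proof.
move=> s0; have l0 : 0 <= laplace_abs s.
  by apply: Rintegral_ge0 => z _; exact: expR_ge0.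
rewrite lt_neqAle l0 andbT eq_sym; apply/negP => /eqP ls0.
have : (\int[rho]_(z in B) `|(expR (- (s * z)))%:E|)%E = 0%E.
  under eq_integral do rewrite abse_EFin ger0_norm ?expR_ge0//.
  by rewrite -[LHS]/(laplace_transform rho s) laplace_transformE// ls0.
move/(ae_eq_integral_abs rho mB); case.
  by apply/measurable_EFinP/measurable_funTS; exact: mlap.
move=> A [mA A0 hA].
have : (rho B <= rho A)%E.
  apply: le_measure; rewrite ?inE// => z Bz; apply: hA => /(_ Bz) [] /eqP.
  by rewrite gt_eqF// expR_gt0.
by rewrite rhoB [X in (_ <= X)%E]A0 leNgt lte01.
Qed.

(** The absolute value gives a test function that is bounded and continuous on the whole line, as
    weak convergence requires, and that agrees with e^(- s z) where rho lives. *)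
Lemma integral_laplace_norm s : 0 <= s ->
  (\int[rho]_z (expR (- s * `|z|))%:E)%E = (laplace_abs s)%:E.
Proof.
move=> s0; rewrite -laplace_transformE// /laplace_transform.
have mn : measurable_fun setT (fun z : R => (expR (- s * `|z|))%:E).
  apply/measurable_EFinP; apply: (measurableT_comp (measurable_expRM (- s))).
  exact: normr_measurable.
rewrite -[in LHS]NBT ge0_integral_setU//; first last.
- by apply/disj_setPS; rewrite dNB.
- by rewrite NBT.
rewrite null_set_integral// ?add0e.
  apply: eq_integral => z; rewrite inE /B /= in_itv/= andbT => z0.
  by rewrite ger0_norm// mulNr.
exact: measurable_funTS.
Qed.

End laplace_transform.

(** * The formula for the transform, and the inverse of the Laplace exponent near zero *)

Section stationary_overshoot.
Context d (T : measurableType d) (R : realType) (P : probability T R).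
Variables (xi : R -> {RV P >-> R}) (psi : R -> R) (gamma : R).
Variable rho : probability R R.
Hypothesis xi_levy : levy_process xi.
Hypothesis xi_nojump : no_negative_jumps xi.
Hypothesis psiE : is_laplace_exponent xi psi.
Hypothesis gammaE : ('E_P[xi 1%R] = gamma%:E)%E.
Hypothesis gamma_gt0 : 0 < gamma.
Hypothesis rhoE : is_stationary_overshoot xi rho.

Let rhoN : rho [set` `]-oo, (0 : R)[] = 0%E.
Proof. by case: rhoE. Qed.

Lemma cvg_passage_transform s : 0 < s ->
  passage_transform _ _ _ P xi s y @[y --> +oo] --> laplace_abs rho s.
Proof.
move=> s0; set f := passage_transform _ _ _ P xi s.
pose F (z : R) := expR (- s * `|z|).
have cF : continuous F.
  move=> z; apply: (@continuous_comp _ _ _ (fun z : R => `|z|) (fun z => expR (- s * z))).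
    exact: norm_continuous.
  exact: continuous_expRM.
have bF : exists M : R, forall z, `|F z| <= M.
  exists 1 => z; rewrite ger0_norm ?expR_ge0// -expR0 ler_expR mulNr oppr_le0.
  by rewrite mulr_ge0// ltW.
have := rhoE.2 F cF bF.
rewrite integral_laplace_norm// ?ltW// => /fine_cvgP[_ cE].
have ce : expR (- s * y) @[y --> +oo] --> (0 : R).
  rewrite (_ : (fun y => _) = (fun z => expR (- z)) \o (fun y => s * y)).
    apply: (@cvg_comp _ _ _ _ _ _ (pinfty_nbhs R)); last exact: cvgr_expR.
    exact: gt0_cvgMry.
  by apply/funext => y; rewrite /= mulNr.
have cD : (fine \o (fun y => 'E_P[fun w => F (overshoot xi y w)])%E) y - expR (- s * y)
    @[y --> +oo] --> laplace_abs rho s.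
  by rewrite -[X in _ --> X]subr0; apply: cvgB.
apply: (squeeze_cvgr _ cD cE).
have : \forall y \near +oo, (0 : R) < y by exact: nbhs_pinfty_gt.
apply: filterS => y y0.
have [b /andP[b0 b1] bE] := passage_transform_overshoot _ _ _ P xi s xi_levy s0 y y0.
by rewrite /= /F bE /= -/(f y); apply/andP; split; lra.
Qed.

(** Stated for any positive root, since that Phi(0) is a root will be deduced from it.
    [passage_laplaceE] is taken along q = mesh: by the Abelian theorem and the slope of psi at 0 its
    left-hand side tends to gamma times the transform, and its right-hand side to psi(s) / (- s) +
    psi(s) / (s - r). *)
Lemma laplace_overshoot_root r s : 0 < r -> psi r = 0 -> 0 < s -> s != r ->
  laplace_abs rho s = r * psi s / (gamma * s * (s - r)).
Proof.
move=> r0 pr s0 sr.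
set A := passage_laplace _ _ _ P xi s.
have cA : mesh m * A (mesh m) @[m --> \oo] --> laplace_abs rho s.
  have h : q * A q @[q --> 0^'+] --> laplace_abs rho s.
    apply: (abel_mean (passage_transform _ _ _ P xi s)).
    - exact: (measurable_passage_transform _ _ _ P xi s xi_levy s0).
    - exact: (passage_transform01 _ _ _ P xi s xi_levy s0).
    - exact: cvg_passage_transform.
  exact: (cvg_comp _ _ (@cvg_mesh R) h).
have cpsi : (mesh m)^-1 * psi (mesh m) @[m --> \oo] --> - gamma.
  apply: (cvg_laplace_exponent_mean _ _ _ P (xi 1)) => //.
  by move=> c c0; rewrite (laplace_exponentE _ _ _ P xi psi psiE 1 c)// mul1r.
have cpsi0 : psi (mesh m) @[m --> \oo] --> (0 : R).
  rewrite (_ : (fun m => _) = (fun m => mesh m * ((mesh m)^-1 * psi (mesh m)))).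
    by rewrite -(mul0r (- gamma)); apply: cvgM => //; exact: cvg_mesh0.
  by apply/funext => m; rewrite mulrA divff ?mul1r// gt_eqF// mesh_gt0.
have c1 : - ((mesh m)^-1 * psi (mesh m)) * (mesh m * A (mesh m)) @[m --> \oo] -->
    gamma * laplace_abs rho s.
  by rewrite -[X in X * _]opprK; apply: cvgM => //; apply: cvgN.
have c2 : (psi s - psi (mesh m)) / (mesh m - s) + psi s / (s - r) @[m --> \oo] -->
    psi s / (- s) + psi s / (s - r).
  apply: cvgD; last exact: cvg_cst.
  rewrite -[X in X / _]subr0 -[X in _ / X]sub0r.
  apply: cvgM; first by apply: cvgB => //; exact: cvg_cst.
  apply: cvgV; first by rewrite sub0r oppr_eq0 gt_eqF.
  by apply: cvgB; [exact: cvg_mesh0|exact: cvg_cst].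
have e12 : \forall m \near \oo, - ((mesh m)^-1 * psi (mesh m)) * (mesh m * A (mesh m)) =
    (psi s - psi (mesh m)) / (mesh m - s) + psi s / (s - r).
  (* The identity asks for q < r and q different from s. *)
  have : \forall m \near \oo, mesh m < Num.min r s.
    by apply: (cvgr_lt 0 (@cvg_mesh0 R)); rewrite lt_min r0.
  apply: filterS => m; rewrite lt_min => /andP[mr ms].
  have m0 := @mesh_gt0 R m.
  rewrite -(passage_laplaceE _ _ _ P xi psi s xi_levy xi_nojump psiE s0 (mesh m) r)//.
  - by rewrite -/A; field; rewrite /= gt_eqF.
  - by rewrite lt_eqF.
  - by rewrite eq_sym.
have : gamma * laplace_abs rho s = psi s / (- s) + psi s / (s - r).
  apply: (cvg_unique _ c1) => //.
  apply: cvg_trans c2; apply: near_eq_cvg.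
  by apply: filterS e12 => m ->.
have g0 : gamma != 0 by rewrite gt_eqF.
move=> h; apply: (mulfI g0); rewrite h.
have s0' : s != 0 by rewrite gt_eqF.
have sr' : s - r != 0 by rewrite subr_eq0.
field; by rewrite ?oppr_eq0 ?g0 ?s0' ?sr'.
Qed.

Lemma expR_psi c : 0 <= c -> (\int[P]_w (expR (- c * xi 1 w))%:E)%E = (expR (psi c))%:E.
Proof. by move=> c0; rewrite (laplace_exponentE _ _ _ P xi psi psiE 1 c)// mul1r. Qed.

Lemma psi0 : psi 0 = 0.
Proof.
have := expR_psi 0 (lexx 0).
under eq_integral do rewrite oppr0 mul0r expR0.
rewrite integral_cst// mul1e [X in X = _ -> _](probability_setT P) => -[] /esym.
by rewrite -expR0 => /expR_inj.
Qed.

(* Both exponentials on the right lie above the tangent line at [x]. *)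
Lemma expR_psi_convex p x y : 0 <= p -> p < x -> x < y ->
  (y - p) * expR (psi x) <= (y - x) * expR (psi p) + (x - p) * expR (psi y).
Proof.
move=> p0 px xy.
have x0 : 0 <= x by lra.
have y0 : 0 <= y by lra.
have yp : 0 <= y - p by lra.
have yx : 0 <= y - x by lra.
have xp : 0 <= x - p by lra.
have mX c : measurable_fun setT (fun w => (expR (- c * xi 1 w))%:E).
  apply/measurable_EFinP; apply: (measurableT_comp (measurable_expRM (- c))).
  exact: measurable_funP.
rewrite -lee_fin EFinD (EFinM (y - p)) (EFinM (y - x)) (EFinM (x - p)).
rewrite -(expR_psi x x0) -(expR_psi p p0) -(expR_psi y y0).
rewrite -!ge0_integralZl_EFin// -ge0_integralD//; last 4 first.
- by move=> w _; rewrite -EFinM lee_fin mulr_ge0 ?expR_ge0.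
- exact: measurable_funeM.
- by move=> w _; rewrite -EFinM lee_fin mulr_ge0 ?expR_ge0.
- exact: measurable_funeM.
apply: ge0_le_integral => //.
- by move=> w _; rewrite -EFinM lee_fin mulr_ge0 ?expR_ge0.
- exact: measurable_funeM.
- by apply: emeasurable_funD; exact: measurable_funeM.
move=> w _; rewrite -!EFinM -EFinD lee_fin; set z := xi 1 w.
have tangent c : expR (- x * z) * (1 + (x - c) * z) <= expR (- c * z).
  have -> : expR (- c * z) = expR (- x * z) * expR ((x - c) * z).
    by rewrite -expRD; congr expR; ring.
  by rewrite ler_wpM2l ?expR_ge0// expR_ge1Dx.
have := ler_wpM2l yx (tangent p); have := ler_wpM2l xp (tangent y).
have -> : (y - p) * expR (- x * z) =
  (y - x) * (expR (- x * z) * (1 + (x - p) * z)) +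
  (x - p) * (expR (- x * z) * (1 + (x - y) * z)) by ring.
lra.
Qed.

(** By convexity e^psi(x) is at most an average, with positive weights, of e^psi(p) = 1 and e^psi(y)
    > 1. *)
Lemma psi_increasing p x y : 0 <= p -> psi p = 0 -> p < x -> x < y -> 0 < psi y ->
  psi x < psi y.
Proof.
move=> p0 pp px xy y0; rewrite -ltr_expR.
have := expR_psi_convex p x y p0 px xy; rewrite pp expR0.
have : 1 < expR (psi y) by rewrite -expR0 ltr_expR.
have yp : 0 < y - p by lra.
move=> h1 h2; rewrite -(ltr_pM2l yp); apply: (le_lt_trans h2).
have := @ltr_pM2l _ (y - x) (ltac:(lra)) 1 (expR (psi y)).
by rewrite h1 mulr1; lra.
Qed.

Variable p : R.
Hypothesis pE : p = Phi psi 0.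
Hypothesis p_gt0 : 0 < p.

(** Without a positive root the supremum would be at most 0. Given a positive root r, a root s > r
    would make the transform vanish at s by the formula, against its positivity; so r is the
    supremum. *)
Lemma psi_Phi0 : psi p = 0.
Proof.
have [r [r0 pr]] : exists r, 0 < r /\ psi r = 0.
  apply: contrapT => h; move: p_gt0; rewrite pE /Phi ltNge => /negP; apply.
  apply: ge_sup; first by exists 0; split; [exact: lexx|exact: psi0].
  by move=> r [_ pr]; rewrite leNgt; apply/negP => r0; apply: h; exists r.
rewrite pE /Phi; suff -> : sup [set s | 0 <= s /\ psi s = 0] = r by [].
have ub : ubound [set s | 0 <= s /\ psi s = 0] r.
  move=> s [s0 ps]; rewrite leNgt; apply/negP => rs.
  have s1 : 0 < s by exact: lt_trans rs.
  have := laplace_abs_gt0 rho rhoN s s0.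
  by rewrite (laplace_overshoot_root r s)// ?gt_eqF// ps mulr0 mul0r ltxx.
apply/eqP; rewrite eq_le; apply/andP; split.
  by apply: ge_sup => //; exists r; split => //; exact: ltW.
by apply: ub_le_sup; [exists r|split => //; exact: ltW].
Qed.

Let L := laplace_abs rho.

(** The formula solved for psi: continuous on the whole line and equal to psi on [0, +oo[. *)
Let H (s : R) := gamma / p * s * (s - p) * L s.

Let H_psi s : 0 <= s -> psi s = H s.
Proof.
have pn : p != 0 by rewrite gt_eqF.
have gn : gamma != 0 by rewrite gt_eqF.
rewrite /H le_eqVlt => /predU1P[<-|s0]; first by rewrite psi0 mulr0 !mul0r.
have [->|sp] := eqVneq s p; first by rewrite psi_Phi0 subrr mulr0 mul0r.
have sn : s != 0 by rewrite gt_eqF.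
have spn : s - p != 0 by rewrite subr_eq0.
rewrite /L (laplace_overshoot_root p s)//; last exact: psi_Phi0.
by field; rewrite ?pn ?gn ?sn ?spn.
Qed.

Let cH : continuous H.
Proof.
move=> s; apply: cvgM; last exact: continuous_laplace_abs.
apply: cvgM; first by apply: cvgMr; exact: cvg_id.
by apply: cvgB; [exact: cvg_id|exact: cvg_cst].
Qed.

Let L_gt0 s : 0 <= s -> 0 < L s.
Proof. exact: laplace_abs_gt0. Qed.

Let psi_gt0 s : p < s -> 0 < psi s.
Proof.
move=> ps; have s0 : 0 < s by exact: lt_trans ps.
have Ls := L_gt0 s (ltW s0).
by rewrite H_psi ?(ltW s0)// /H !mulr_gt0 ?invr_gt0 ?subr_gt0.
Qed.

Let psi_lt0 s : 0 < s -> s < p -> psi s < 0.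
Proof.
move=> s0 sp; have Ls := L_gt0 s (ltW s0).
rewrite H_psi ?(ltW s0)// /H pmulr_llt0// pmulr_rlt0 ?subr_lt0//.
by rewrite mulr_gt0// divr_gt0.
Qed.

(** [H] changes sign across p, so the intermediate value theorem gives a root of psi = t close to p
    for small t of either sign. Beyond [b], psi exceeds [psi b > t], so the supremum lies in the
    same small interval. *)
Let Phi_near e : 0 < e -> \forall t \near 0,
  [/\ `|Phi psi t - p| <= e, 0 <= Phi psi t & psi (Phi psi t) = t].
Proof.
(* The cap p / 2 keeps the left endpoint p - e' positive. *)
move=> e0; pose e' := Num.min e (p / 2).
have e'0 : 0 < e' by rewrite lt_min e0 divr_gt0.
have e'e : e' <= e by rewrite ge_min lexx.
have e'p : e' < p.
  by rewrite gt_min orbC ltr_pdivrMr// ltr_pMr// ltr1n.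
have [a0 ap] : 0 < p - e' /\ p - e' < p by rewrite subr_gt0 ltrBlDr ltrDl.
have pb : p < p + e' by rewrite ltrDl.
have [ae be] : p - e <= p - e' /\ p + e' <= p + e by rewrite lerD2l lerN2 lerD2l.
move: (p - e') (p + e') a0 ap pb ae be => a b a0 ap pb ae be.
have Ha : H a < 0 by rewrite -(H_psi a (ltW a0)); exact: psi_lt0.
have b0 : 0 <= b := ltW (lt_trans p_gt0 pb).
have Hb : 0 < H b by rewrite -(H_psi b b0); exact: psi_gt0.
have Hat : \forall t \near (0 : R), H a < t by exact: lt_nbhsr.
have Hbt : \forall t \near (0 : R), t < H b by exact: lt_nbhsl.
apply: filterS2 Hat Hbt => t ta tb.
have ab : a <= b := ltW (lt_trans ap pb).
have [c] : exists2 c, c \in `[a, b] & H c = t.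
  apply: IVT => //; first exact: continuous_subspaceT.
  have Hab := ltW (lt_trans ta tb).
  by rewrite (min_idPl Hab) (max_idPr Hab) !ltW.
rewrite in_itv/= => /andP[ac cb] Hc.
have c0 : 0 <= c := le_trans (ltW a0) ac.
set S := [set s | 0 <= s /\ psi s = t].
have Sc : S c by split => //; rewrite H_psi.
have ubS : ubound S b.
  move=> s [s0 st]; rewrite leNgt; apply/negP => bs.
  have := psi_increasing p b s (ltW p_gt0) psi_Phi0 pb bs (psi_gt0 s (lt_trans pb bs)).
  by rewrite st H_psi// => /(lt_trans tb); rewrite ltxx.
have hS : has_sup S by split; [exists c|exists b].
have cPhi : c <= Phi psi t by apply: ub_le_sup => //; exists b.
have Phib : Phi psi t <= b by apply: ge_sup => //; exists c.
have Phi0 : 0 <= Phi psi t by exact: le_trans cPhi.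
split => //.
  rewrite ler_distl (le_trans ae (le_trans ac cPhi))/=.
  exact: le_trans Phib be.
(* The supremum itself solves the equation: [H] takes the value t at points of [S] arbitrarily close
   to it and is continuous. *)
rewrite H_psi//; apply/eqP; rewrite -subr_eq0 -normr_le0; apply/ler_addgt0Pr => eta eta0.
rewrite add0r.
have /cvgrPdist_lt/(_ eta eta0)[r /= r0 hr] := cH (Phi psi t).
have [s [s0 st] sr] := sup_adherent r0 hS.
have sPhi : s <= Phi psi t by apply: ub_le_sup => //; exists b.
have := hr s; rewrite -(H_psi s)// st => h; apply/ltW/h.
by rewrite /= ger0_norm ?subr_ge0// ltrBlDr -ltrBlDl.
Qed.

(** With u = Phi(h), the equation h = H(u) turns the difference quotient (u - p) / h into p / (gamma
    u L(u)), and u tends to p. *)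
Lemma is_derive_Phi : is_derive (0 : R) 1 (Phi psi) (gamma * L p)^-1.
Proof.
have cPhi : Phi psi t @[t --> 0^'] --> p.
  apply/cvgrPdist_lt => e e0; apply: cvg_within.
  have := Phi_near (e / 2) (divr_gt0 e0 (ltr0n _ 2)).
  by apply: filterS => t [h _ _]; rewrite distrC (le_lt_trans h)//; lra.
have quot : h^-1 *: (Phi psi (h *: 1 + 0) - Phi psi 0) @[h --> 0^'] -->
    (gamma * L p)^-1.
  have c : p / (gamma * Phi psi h * L (Phi psi h)) @[h --> 0^'] --> p / (gamma * p * L p).
    apply: cvgMr; apply: cvgV.
      by rewrite gt_eqF// !mulr_gt0// L_gt0// ltW.
    apply: cvgM; first by apply: cvgMr.
    by apply: (cvg_comp _ _ cPhi); exact: continuous_laplace_abs.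
  have -> : (gamma * L p)^-1 = p / (gamma * p * L p).
    have Lp := L_gt0 p (ltW p_gt0).
    by field; rewrite ?gt_eqF.
  apply: cvg_trans c; apply: near_eq_cvg.
  have p20 : 0 < p / 2 by rewrite divr_gt0.
  have h1 : \forall t \near (0 : R)^', [/\ `|Phi psi t - p| <= p / 2,
      0 <= Phi psi t & psi (Phi psi t) = t].
    by apply: cvg_within; exact: Phi_near.
  have h2 : \forall h \near (0 : R)^', h != 0 by exact: nbhs_dnbhs_neq.
  apply: filterS2 h1 h2 => h [hp u0 uh] h0.
  rewrite /GRing.scale/= mulr1 addr0 -pE.
  move: hp u0 uh; move: (Phi psi h) => u hp u0 uh.
  have u1 : 0 < u by move: hp; rewrite ler_distl; lra.
  have up : u - p != 0.
    by apply: contra h0; rewrite subr_eq0 => /eqP up; rewrite -uh up psi_Phi0.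
  have Lu := L_gt0 u u0.
  rewrite -uh H_psi// /H.
  by field; rewrite up !gt_eqF.
apply: DeriveDef; first by apply/cvg_ex; exists (gamma * L p)^-1.
exact: cvg_lim quot.
Qed.

End stationary_overshoot.

Theorem lemma3 (d : measure_display) (T : measurableType d) (R : realType)
  (P : probability T R) (xi : R -> {RV P >-> R}) (psi : R -> R) (p gamma : R)
  (rho : probability R R)
  (xi_sp : spectrally_positive xi)
  (psiE : is_laplace_exponent xi psi)
  (pE : p = Phi psi 0) (p_gt0 : 0 < p)
  (gammaE : ('E_P[xi 1%R] = gamma%:E)%E) (gamma_gt0 : 0 < gamma)
  (rhoE : is_stationary_overshoot xi rho) :
  (exists g : R -> R,
    is_continuous_extension [set` `[0, +oo[] [set 0; p]
      (fun s => p * psi s / (gamma * s * (s - p))) g /\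
    forall s : R, 0 <= s -> laplace_transform rho s = (g s)%:E) /\
  derivable (Phi psi) 0 1 /\
  laplace_transform rho p = ((gamma * derive1 (Phi psi) 0)^-1)%:E.

Proof.
have [xi_levy xi_nojump _] := xi_sp.
have rhoN : rho [set` `]-oo, (0 : R)[] = 0%E by case: rhoE.
have pp : psi p = 0.
  exact: (psi_Phi0 _ _ _ P xi psi gamma rho xi_levy xi_nojump psiE gammaE
    gamma_gt0 rhoE p pE p_gt0).
have dPhi := is_derive_Phi _ _ _ P xi psi gamma rho xi_levy xi_nojump psiE gammaE
  gamma_gt0 rhoE p pE p_gt0.
split; last split.
(* The transform itself is the continuous extension. *)
- exists (laplace_abs rho); split; last by move=> s s0; rewrite laplace_transformE.
  split; last by apply: continuous_subspaceT; exact: continuous_laplace_abs.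
  move=> s; rewrite /= in_itv/= andbT => s0 /not_orP[/eqP sn0 /eqP snp].
  apply: (laplace_overshoot_root _ _ _ P xi psi gamma rho xi_levy xi_nojump psiE
    gammaE gamma_gt0 rhoE p s) => //.
  by rewrite lt_neqAle eq_sym sn0.
- by case: dPhi.
- rewrite laplace_transformE ?ltW// derive1E (@derive_val _ _ _ _ _ _ _ dPhi).
  have Lp : 0 < laplace_abs rho p by apply: laplace_abs_gt0 => //; exact: ltW.
  by congr EFin; field; rewrite !gt_eqF.
Qed.
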